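(* Let $b\ge 2$ be an integer. Every nonnegative integer can be written as $2x^2+by^2+(z^2+zw+w^2)$ with $x,y,z,w\in\mathbb{Z}$ if and only if $b\in\{2,3,4,5,6,7,8,9,10\}$. *)

(* Defs.v *)
From Stdlib Require Import ZArith.
Open Scope Z_scope.

Definition form (b x y z w : Z) : Z :=
  2 * x ^ 2 + b * y ^ 2 + (z ^ 2 + z * w + w ^ 2).

Definition universal (b : Z) : Prop :=
  forall n : Z, 0 <= n -> exists x y z w : Z, form b x y z w = n.

(* Main.v *)
(** Three squares suffice: if [6 m = a^2 + b^2 + c^2] then, after sign changes,
    [a = b = c] modulo 3, and a linear change of variables turns this into
    [m = 2 x^2 + z^2 + z w + w^2].  Legendre's three-square theorem thus shows that this
    ternary form represents every [m] outside [4^k (16 l + 10)], and for [b <= 10] the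
    remaining numbers [16 l + 10] are handled by subtracting [b] or [4 b]; conversely
    [10] is not represented when [y = 0], which forces [b <= 10].

    For the three-square theorem, let [n] be squarefree.  A prime [q = 1] modulo 4 is chosen
    so that [n t^2 = x^2 + d y^2] satisfies Legendre's local conditions for [d = q] or
    [d = 2 q]; a pigeonhole argument solves this equation, [d] is a sum of two squares, and
    Aubry's descent makes the resulting rational representation of [n] integral.

    The conditions on [q] only prescribe the values of real characters, so a weak form of
    Dirichlet's theorem is enough.  For a real nonprincipal character [chi], the hyperbola
    method applied to the sum of [(1 * chi)(m) / sqrt m] keeps the partial sums of
    [chi(m) / m] away from [0], and hence the sum of [chi(p) ln p / p] over primes stays
    bounded, whereas the sum of [ln p / p] diverges. *)

Require Import Defs.
From Stdlib Require Import ZArith Lia.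
From HB Require Import structures.
From mathcomp Require Import all_boot all_order all_algebra all_field.
From mathcomp Require Import reals sequences exp Rstruct.
From mathcomp Require Import ring lra zify.

Set Implicit Arguments.
Unset Strict Implicit.
Unset Printing Implicit Defensive.
Import Order.TTheory GRing.Theory Num.Theory.

Local Open Scope ring_scope.

(** * Sums of real characters *)

(** The cube equation confines the values to 0, 1 and -1, and it passes directly to products of
    characters. *)
Record real_char (R : realType) (M : nat) (chi : nat -> R) : Prop := RealChar {
  rchar1 : chi 1%N = 1;
  rcharM : forall a b, chi (a * b)%N = chi a * chi b;
  rchar_period : forall a, chi (a + M)%N = chi a;
  rchar_cube : forall a, chi a ^+ 3 = chi a }.

Section RealCharacter.
Variables (R : realType) (M : nat) (chi : nat -> R).
Hypothesis chiP : real_char M chi.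

Lemma rchar_modn a : chi (a %% M)%N = chi a.
Proof.
rewrite {2}(divn_eq a M) addnC; elim: (a %/ M)%N => [|k IH]; first by rewrite addn0.
by rewrite mulSn addnCA addnC (rchar_period chiP).
Qed.

Lemma rcharX a k : chi (a ^ k)%N = chi a ^+ k.
Proof.
elim: k => [|k IH]; first by rewrite expn0 (rchar1 chiP).
by rewrite expnS (rcharM chiP) IH exprS.
Qed.

Lemma rchar_val a : [\/ chi a = 0, chi a = 1 | chi a = -1].
Proof.
have /eqP := rchar_cube chiP a.
have -> : (chi a ^+ 3 == chi a) = (chi a * ((chi a - 1) * (chi a + 1)) == 0).
  by rewrite -subr_eq0; congr (_ == _); ring.
rewrite !mulf_eq0 subr_eq0 addr_eq0 => /or3P[] /eqP ->.
- by constructor 1.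
- by constructor 2.
- by constructor 3.
Qed.

Lemma rchar_norm a : `|chi a| <= 1.
Proof. by case: (rchar_val a) => ->; rewrite ?normrN ?normr0 ?normr1. Qed.

(** Multiplication by [c] permutes the residues modulo [M], so the sum equals [chi c] times
    itself. *)
Lemma rchar_sum_period : (0 < M)%N ->
  (exists2 c, coprime c M & chi c != 1) -> \sum_(0 <= i < M) chi i = 0.
Proof.
move=> M_gt0 [c coMc chic]; rewrite big_mkord.
pose h (i : 'I_M) : 'I_M := Ordinal (ltn_pmod (c * i) M_gt0).
have h_inj : injective h.
  move=> i j /(congr1 val) /= /eqP.
  have wlog_le (k l : 'I_M) : (k <= l)%N -> (c * k == c * l %[mod M])%N -> k = l.
    move=> le_kl; rewrite eq_sym eqn_mod_dvd ?leq_mul2l ?le_kl ?orbT //.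
    rewrite -mulnBr Gauss_dvdr; last by rewrite coprime_sym.
    move=> dvd; apply/val_inj/eqP => /=.
    have : (l - k < M)%N by rewrite (leq_ltn_trans (leq_subr _ _)).
    case: (posnP (l - k)) => [/eqP|pos lt]; last by move: (dvdn_leq pos dvd); rewrite leqNgt lt.
    by rewrite subn_eq0 eqn_leq le_kl.
  have [le_ij|/ltnW le_ji] := leqP i j; first exact: wlog_le.
  by rewrite eq_sym => /wlog_le ->.
have : \sum_(i < M) chi i = chi c * \sum_(i < M) chi i.
  rewrite {1}(reindex_inj h_inj) mulr_sumr /=; apply: eq_bigr => i _.
  by rewrite rchar_modn (rcharM chiP).
move/eqP; rewrite -subr_eq0 -{1}[X in X - _]mul1r -mulrBl mulf_eq0 subr_eq0 eq_sym.
by rewrite (negbTE chic) => /eqP.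
Qed.

(** Full periods cancel, so a sum starting at 0 reduces to fewer than [M] terms of absolute value at
    most 1; a general sum is a difference of two such sums. *)
Lemma rchar_sum_bound : (0 < M)%N ->
  (exists2 c, coprime c M & chi c != 1) ->
  forall a b, (a <= b)%N -> `|\sum_(a <= i < b) chi i| <= M%:R + M%:R.
Proof.
move=> M_gt0 chiN.
have pre n : `|\sum_(0 <= i < n) chi i| <= M%:R.
  have -> : \sum_(0 <= i < n) chi i = \sum_(0 <= i < (n %% M)%N) chi i.
    rewrite {1}(divn_eq n M); elim: (n %/ M)%N => [|k IH] //.
    rewrite mulSn -addnA (@big_cat_nat _ _ _ M) ?leq_addr //=.
    rewrite rchar_sum_period // add0r -IH.
    rewrite -{1}(add0n M) big_addn addKn; apply: eq_bigr => i _.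
    by rewrite (rchar_period chiP).
  apply: le_trans (ler_norm_sum _ _ _) _.
  apply: le_trans (_ : \sum_(0 <= i < (n %% M)%N) 1 <= _).
    by apply: ler_sum => i _; apply: rchar_norm.
  by rewrite sumr_const_nat subn0 ler_nat ltnW ?ltn_pmod.
move=> a b le_ab.
have -> : \sum_(a <= i < b) chi i = \sum_(0 <= i < b) chi i - \sum_(0 <= i < a) chi i.
  by rewrite [X in _ = X - _](@big_cat_nat _ _ _ a) //= addrAC subrr add0r.
by rewrite (le_trans (ler_normB _ _)) // lerD.
Qed.

End RealCharacter.

(** Summation by parts: each induction step adds [U * (f c - f c.+1)], with [U] a partial sum of
    [u], so the errors telescope to [K * (f a - f c)], and the boundary term costs [K * f c]. *)
Lemma abel_bound (R : realType) (u f : nat -> R) (K : R) (a b : nat) :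
  (forall j, (a <= j)%N -> `|\sum_(a <= i < j) u i| <= K) ->
  (forall i, (a <= i)%N -> f i.+1 <= f i) -> (forall i, (a <= i)%N -> 0 <= f i) ->
  `|\sum_(a <= i < b) u i * f i| <= K * f a.
Proof.
move=> uK fdec fpos.
have K_ge0 : 0 <= K by apply: le_trans (uK a (leqnn a)).
have [le_ba|lt_ab] := leqP b a.
  by rewrite big_geq // normr0 mulr_ge0 // fpos.
suff main c : (a <= c)%N ->
    `|\sum_(a <= i < c.+1) u i * f i - (\sum_(a <= i < c.+1) u i) * f c| <= K * (f a - f c).
  case: b lt_ab => // c; rewrite ltnS => le_ac.
  set S := \sum_(_ <= _ < _) _; set U := \sum_(a <= i < c.+1) u i.
  have -> : S = (S - U * f c) + U * f c by rewrite subrK.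
  apply: le_trans (ler_normD _ _) _.
  have -> : K * f a = K * (f a - f c) + K * f c by ring.
  apply: lerD; first exact: main.
  by rewrite normrM (ger0_norm (fpos _ le_ac)) ler_wpM2r ?fpos ?uK // leqW.
elim: c => [|c IH] le_ac.
  by move: le_ac; rewrite leqn0 => /eqP ->; rewrite !big_nat1 !subrr normr0 mulr0.
move: le_ac; rewrite leq_eqVlt => /orP[/eqP <-|]; first by rewrite !big_nat1 !subrr normr0 mulr0.
rewrite ltnS => le_ac.
rewrite (@big_nat_recr _ _ _ c.+1) ?(leqW le_ac) //= (@big_nat_recr _ _ _ c.+1 _ u) ?(leqW le_ac) //=.
set S := \sum_(_ <= _ < _) _; set U := \sum_(a <= i < c.+1) u i.
have -> : S + u c.+1 * f c.+1 - (U + u c.+1) * f c.+1 = (S - U * f c) + U * (f c - f c.+1) by ring.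
apply: le_trans (ler_normD _ _) _.
have -> : K * (f a - f c.+1) = K * (f a - f c) + K * (f c - f c.+1) by ring.
apply: lerD; first exact: IH.
by rewrite normrM (@ger0_norm _ (f c - _)) ?subr_ge0 ?fdec // ler_wpM2r ?subr_ge0 ?fdec ?uK // leqW.
Qed.

(** * Divisor sums of a real character *)

Lemma sum_nat_multiples (V : nmodType) (F : nat -> V) d x : (0 < d)%N ->
  \sum_(1 <= m < x.+1 | (d %| m)%N) F m = \sum_(1 <= j < (x %/ d).+1) F (d * j)%N.
Proof.
move=> d_gt0; elim: x => [|x IH]; first by rewrite div0n !big_geq.
rewrite big_mkcond (@big_nat_recr _ _ _ x.+1) //= -big_mkcond /= IH divnS //.
case: ifP => /= [dvd|_]; last by rewrite addr0.
rewrite add1n [RHS](@big_nat_recr _ _ _ (x %/ d).+1) //=; congr (_ + F _).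
move: (divnS x d_gt0); rewrite dvd add1n => <-.
by rewrite mulnC divnK.
Qed.

Lemma sum_nat_divisors (V : nmodType) (F : nat -> nat -> V) x :
  \sum_(1 <= m < x.+1) \sum_(1 <= a < x.+1 | (a %| m)%N) F a m =
  \sum_(1 <= a < x.+1) \sum_(1 <= j < (x %/ a).+1) F a (a * j)%N.
Proof.
rewrite (exchange_big_dep_nat xpredT) //=; apply: eq_big_nat => a /andP[a_gt0 _].
exact: sum_nat_multiples.
Qed.

Section DivisorSum.
Variables (R : realType) (M : nat) (chi : nat -> R).
Hypothesis chiP : real_char M chi.

(** This is the Dirichlet convolution [1 * chi]. *)
Definition divisor_sum m := \sum_(1 <= a < m.+1 | (a %| m)%N) chi a.

Lemma divisor_sum_widen m x : (0 < m <= x)%N ->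
  divisor_sum m = \sum_(1 <= a < x.+1 | (a %| m)%N) chi a.
Proof.
move=> /andP[m_gt0 le_mx]; rewrite /divisor_sum (@big_nat_widen _ _ _ _ _ x.+1) //.
by apply: eq_bigl => a; apply: andb_idr => /dvdn_leq; rewrite ltnS; apply.
Qed.

Lemma divisor_sum1 : divisor_sum 1 = 1.
Proof. by rewrite /divisor_sum big_mkcond big_nat1 dvdnn (rchar1 chiP). Qed.

(** A divisor of [p ^ k.+1 * m] is either prime to [p], hence a divisor of [m], or [p] times a
    divisor of [p ^ k * m]. *)
Lemma divisor_sum_primeS p k m : prime p -> coprime p m -> (0 < m)%N ->
  divisor_sum (p ^ k.+1 * m) = divisor_sum m + chi p * divisor_sum (p ^ k * m).
Proof.
move=> p_pr co_pm m_gt0; have p_gt0 := prime_gt0 p_pr.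
rewrite [LHS]/divisor_sum (bigID (fun a => (p %| a)%N)) [LHS]addrC /=; congr (_ + _).
  rewrite (@divisor_sum_widen m (p ^ k.+1 * m)).
    apply: eq_bigl => a; apply/andP/idP => [[dvd_a Np_a]|dvd_a].
      by rewrite -(@Gauss_dvdr _ (p ^ k.+1)) // coprime_sym coprimeXl // prime_coprime.
    split; first exact: dvdn_mull.
    rewrite -prime_coprime //; exact: coprime_dvdr dvd_a co_pm.
  by rewrite m_gt0 leq_pmull ?expn_gt0 ?p_gt0.
rewrite (eq_bigl (fun a => (p %| a)%N && (a %| p ^ k.+1 * m)%N)); last by move=> a; rewrite andbC.
rewrite big_mkcondr sum_nat_multiples //.
rewrite expnS -mulnA mulKn // /divisor_sum mulr_sumr [RHS]big_mkcond /=.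
by apply: eq_bigr => a _; rewrite dvdn_pmul2l // (rcharM chiP).
Qed.

Lemma divisor_sum_prime_power p k m : prime p -> coprime p m -> (0 < m)%N ->
  divisor_sum (p ^ k * m) = (\sum_(0 <= i < k.+1) chi p ^+ i) * divisor_sum m.
Proof.
move=> p_pr co_pm m_gt0; elim: k => [|k IH]; first by rewrite big_nat1 mul1n mul1r.
rewrite divisor_sum_primeS // IH [in RHS]big_nat_recl //= expr0 mulrDl mul1r mulrA.
congr (_ + _ * _); rewrite mulr_sumr; apply: eq_bigr => i _.
by rewrite exprS.
Qed.

(** According to [chi a], the sum is 1, or [k + 1], or alternates between 1 and 0. Even exponents
    are those met in squares. *)
Lemma rchar_geometric_ge a k :
  0 <= \sum_(0 <= i < k.+1) chi a ^+ i /\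
  (~~ odd k -> 1 <= \sum_(0 <= i < k.+1) chi a ^+ i).
Proof.
have [ca|ca|ca] := rchar_val chiP a; rewrite ca.
- have -> : \sum_(0 <= i < k.+1) (0 : R) ^+ i = 1.
    by rewrite big_nat_recl //= big1 ?addr0 // => i _; rewrite expr0n.
  by split.
- under eq_bigr do rewrite expr1n.
  by rewrite sumr_const_nat subn0; split=> // _; rewrite ler1n.
- have -> : \sum_(0 <= i < k.+1) (-1 : R) ^+ i = (~~ odd k)%:R.
    elim: k => [|k IH]; first by rewrite big_nat1.
    rewrite big_nat_recr //= IH negbK -signr_odd /=.
    by case: (odd k); rewrite ?expr0 ?expr1 ?add0r ?subrr.
  by case: (odd k); split.
Qed.

Lemma divisor_sum_ge0 m : (0 < m)%N -> 0 <= divisor_sum m.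
Proof.
elim/ltn_ind: m => m IH m_gt0; have [m_gt1|] := ltnP 1 m; last first.
  by rewrite leq_eqVlt ltnNge m_gt0 orbF => /eqP ->; rewrite divisor_sum1.
have p_pr := pdiv_prime m_gt1; have [m' co_pm' def_m] := pfactor_coprime p_pr m_gt0.
have m'_gt0 : (0 < m')%N by move: m_gt0; rewrite def_m muln_gt0 => /andP[].
rewrite def_m mulnC divisor_sum_prime_power // mulr_ge0 //.
  by case: (rchar_geometric_ge (pdiv m) (logn (pdiv m) m)).
apply: IH => //; rewrite [X in (_ < X)%N]def_m -[X in (X < _)%N]muln1 ltn_pmul2l //.
by rewrite -(expn0 (pdiv m)) ltn_exp2l ?prime_gt1 // logn_gt0 pi_pdiv.
Qed.

(** All prime exponents of a square are even, so every local factor is at least 1. These values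
    produce the harmonic sum in [harmonic_le_rchar_psum]. *)
Lemma divisor_sum_square_ge1 m : (0 < m)%N -> 1 <= divisor_sum (m ^ 2).
Proof.
elim/ltn_ind: m => m IH m_gt0; have [m_gt1|] := ltnP 1 m; last first.
  by rewrite leq_eqVlt ltnNge m_gt0 orbF => /eqP ->; rewrite exp1n divisor_sum1.
have p_pr := pdiv_prime m_gt1; have [m' co_pm' def_m] := pfactor_coprime p_pr m_gt0.
have m'_gt0 : (0 < m')%N by move: m_gt0; rewrite def_m muln_gt0 => /andP[].
rewrite def_m mulnC expnMn -expnM divisor_sum_prime_power //; last 2 first.
- by rewrite coprimeXr.
- by rewrite expn_gt0 m'_gt0.
rewrite -[leLHS]mulr1 ler_pM //.
  case: (rchar_geometric_ge (pdiv m) (logn (pdiv m) m * 2)) => _; apply.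
  by rewrite muln2 odd_double.
apply: IH => //; rewrite [X in (_ < X)%N]def_m -[X in (X < _)%N]muln1 ltn_pmul2l //.
by rewrite -(expn0 (pdiv m)) ltn_exp2l ?prime_gt1 // logn_gt0 pi_pdiv.
Qed.

End DivisorSum.

(** * Partial sums of inverse square roots *)

Section SqrtSums.
Variable R : realType.
Local Notation s n := (Num.sqrt (n%:R : R)).

Lemma sqrt_nat_gt0 n : (0 < n)%N -> 0 < s n.
Proof. by move=> n_gt0; rewrite sqrtr_gt0 ltr0n. Qed.

Lemma sqr_sqrt_nat n : s n ^+ 2 = n%:R.
Proof. by rewrite sqr_sqrtr. Qed.

Lemma sqrt_natM m n : s (m * n) = s m * s n.
Proof. by rewrite natrM sqrtrM. Qed.

Lemma sqrt_nat_incr_lower n : (s n.+1)^-1 <= 2 * (s n.+1 - s n).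
Proof.
have v_gt0 : 0 < s n.+1 by apply: sqrt_nat_gt0.
have := sqr_sqrt_nat n; have : s n.+1 ^+ 2 = n%:R + 1 by rewrite sqr_sqrt_nat natr1.
move: v_gt0; set u := s n; set v := s n.+1 => v_gt0 vE uE.
rewrite -[_^-1]mul1r ler_pdivrMr //; have := sqr_ge0 (v - u); nra.
Qed.

Lemma sqrt_nat_incr_upper n : (0 < n)%N -> 2 * (s n.+1 - s n) <= (s n)^-1.
Proof.
move=> n_gt0; have u_gt0 := sqrt_nat_gt0 n_gt0.
have := sqr_sqrt_nat n; have : s n.+1 ^+ 2 = n%:R + 1 by rewrite sqr_sqrt_nat natr1.
move: u_gt0; set u := s n; set v := s n.+1 => u_gt0 vE uE.
rewrite -[_^-1]mul1r ler_pdivlMr //; have := sqr_ge0 (v - u); nra.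
Qed.

Definition inv_sqrt_sum n : R := \sum_(1 <= j < n.+1) (s j)^-1.
(** The error of the integral approximation [2 * sqrt n]; it decreases, with limit the zeta value at
    1/2. *)
Definition inv_sqrt_excess n : R := inv_sqrt_sum n - 2 * s n.

Lemma inv_sqrt_excess_noninc m n : (m <= n)%N -> inv_sqrt_excess n <= inv_sqrt_excess m.
Proof.
move=> le_mn; rewrite -(subnK le_mn); elim: (n - m)%N => [|k IH] //.
apply: le_trans IH; rewrite addSn /inv_sqrt_excess /inv_sqrt_sum.
rewrite (@big_nat_recr _ _ _ (k + m).+1) //=.
have := sqrt_nat_incr_lower (k + m); lra.
Qed.

(** Subtracting [(s n)^-1] turns the decreasing excess into a nondecreasing sequence. *)
Lemma inv_sqrt_excess_gap m n : (0 < m <= n)%N ->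
  inv_sqrt_excess m <= inv_sqrt_excess n + (s m)^-1.
Proof.
move=> /andP[m_gt0 le_mn].
suff : inv_sqrt_excess m - (s m)^-1 <= inv_sqrt_excess n - (s n)^-1.
  have : 0 <= (s n)^-1 by rewrite invr_ge0 sqrtr_ge0.
  lra.
rewrite -(subnK le_mn); elim: (n - m)%N => [|k IH] //.
apply: le_trans IH _; rewrite addSn /inv_sqrt_excess /inv_sqrt_sum.
rewrite (@big_nat_recr _ _ _ (k + m).+1) //=.
have := @sqrt_nat_incr_upper (k + m); rewrite addn_gt0 m_gt0 orbT => /(_ isT); lra.
Qed.

Lemma inv_sqrt_excess_bounds n : -2 <= inv_sqrt_excess n <= 0.
Proof.
have e0 : inv_sqrt_excess 0 = 0.
  by rewrite /inv_sqrt_excess /inv_sqrt_sum big_geq // sqrtr0 mulr0 subr0.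
have e1 : inv_sqrt_excess 1 = -1.
  by rewrite /inv_sqrt_excess /inv_sqrt_sum big_nat1 sqrtr1 invr1; lra.
apply/andP; split; last by rewrite -e0 inv_sqrt_excess_noninc.
case: n => [|n]; first by rewrite e0; lra.
by have := @inv_sqrt_excess_gap 1 n.+1 isT; rewrite e1 sqrtr1 invr1; lra.
Qed.

End SqrtSums.

Lemma sum_squares_le (R : realType) (F : nat -> R) N :
  (forall m, (0 < m)%N -> 0 <= F m) ->
  \sum_(1 <= k < N.+1) F (k ^ 2)%N <= \sum_(1 <= m < (N ^ 2).+1) F m.
Proof.
move=> F_ge0; elim: N => [|N IH]; first by rewrite !big_geq.
rewrite (@big_nat_recr _ _ _ N.+1) //= (@big_nat_recr _ _ _ (N.+1 ^ 2)) ?expn_gt0 //=.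
rewrite lerD2r (le_trans IH) //.
rewrite [leRHS](@big_cat_nat _ _ _ (N ^ 2).+1) //=; last by rewrite ltn_exp2r.
rewrite lerDl big_nat_cond sumr_ge0 // => i; rewrite andbT => /andP[lt_i _].
by apply: F_ge0; apply: leq_trans lt_i.
Qed.

(** * Nonvanishing of [L(1, chi)] through its partial sums *)

Section Nonvanishing.
Variables (R : realType) (M : nat) (chi : nat -> R).
Hypothesis chiP : real_char M chi.
Hypothesis M_gt0 : (0 < M)%N.
Hypothesis chiN : exists2 c, coprime c M & chi c != 1.
Local Notation s n := (Num.sqrt (n%:R : R)).
Local Notation K := (M%:R + M%:R : R).

Definition rchar_psum x := \sum_(1 <= m < x.+1) chi m / m%:R.

Lemma rchar_weighted_sum a b (f : nat -> R) :
  (forall i, (a <= i)%N -> f i.+1 <= f i) -> (forall i, (a <= i)%N -> 0 <= f i) ->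
  `|\sum_(a <= i < b) chi i * f i| <= K * f a.
Proof.
move=> fdec fpos; apply: abel_bound => // j le_aj.
exact: rchar_sum_bound.
Qed.

Lemma rchar_psum_cauchy x y : (x <= y)%N ->
  `|rchar_psum y - rchar_psum x| <= K / x.+1%:R.
Proof.
move=> le_xy; rewrite /rchar_psum (@big_cat_nat _ _ _ x.+1 1 y.+1) //= addrAC subrr add0r.
apply: rchar_weighted_sum => i lt_i.
  by rewrite lef_pV2 ?posrE ?ltr0n ?ler_nat // (leq_trans _ lt_i).
by rewrite invr_ge0.
Qed.

Lemma rchar_psum_le x : `|rchar_psum x| <= K.
Proof.
have := rchar_psum_cauchy (leq0n x).
by rewrite /rchar_psum (@big_geq _ _ _ _ 1) // subr0 divr1.
Qed.

Lemma rchar_inv_sqrt_sum a b : (0 < a)%N ->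
  `|\sum_(a <= i < b) chi i * (s i)^-1| <= K * (s a)^-1.
Proof.
move=> a_gt0; apply: rchar_weighted_sum => i le_ai; last by rewrite invr_ge0 sqrtr_ge0.
by rewrite lef_pV2 ?posrE ?sqrt_nat_gt0 ?ler_sqrt ?ler_nat // (leq_trans a_gt0).
Qed.

(** The inner sum is close to [2 * N / sqrt a + g]. The first term yields the multiple of
    [rchar_psum N]; the constant [g], at most 2 in absolute value, yields [2 * K]; the [N] remaining
    errors are at most [2 / N] each. *)
Lemma hyperbola_head N : (0 < N)%N ->
  \sum_(1 <= a < N.+1) chi a * (s a)^-1 * inv_sqrt_sum R (N ^ 2 %/ a)
    <= 2 * N%:R * rchar_psum N + 2 * K + 2.
Proof.
move=> N_gt0; set g := inv_sqrt_excess R (N ^ 2).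
pose d a := inv_sqrt_sum R (N ^ 2 %/ a) - (2 * N%:R / s a + g).
have -> : \sum_(1 <= a < N.+1) chi a * (s a)^-1 * inv_sqrt_sum R (N ^ 2 %/ a) =
    2 * N%:R * rchar_psum N + g * (\sum_(1 <= a < N.+1) chi a * (s a)^-1) +
    \sum_(1 <= a < N.+1) chi a * (s a)^-1 * d a.
  rewrite /rchar_psum !mulr_sumr -!big_split /=; apply: eq_big_nat => a /andP[a_gt0 _].
  have := sqr_sqrt_nat R a; have : s a != 0 by rewrite gt_eqF ?sqrt_nat_gt0.
  rewrite /d; move: (s a) => t t_neq0 <-; by field.
rewrite -addrA -[leRHS]addrA lerD2l; apply: lerD.
  apply: le_trans (ler_norm _) _; rewrite normrM ler_pM //.
    have /andP[g1 g2] := inv_sqrt_excess_bounds R (N ^ 2).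
    by rewrite ler_norml /g g1 /=; lra.
  by have := @rchar_inv_sqrt_sum 1 N.+1 isT; rewrite sqrtr1 invr1 mulr1.
have sN : N%:R = s (N ^ 2) by rewrite -mulnn sqrt_natM -expr2 sqr_sqrt_nat.
have N0 : 0 < N%:R :> R by rewrite ltr0n.
apply: le_trans (_ : \sum_(1 <= a < N.+1) 2 / N%:R <= _); last first.
  by rewrite sumr_const_nat subn1 /= -[leLHS]mulr_natr divfK ?gt_eqF.
apply: ler_sum_nat => a /andP[a_gt0]; rewrite ltnS => le_aN.
set B := (N ^ 2 %/ a)%N.
have B_gt0 : (0 < B)%N by rewrite divn_gt0 // (leq_trans le_aN) // -mulnn leq_pmull.
have le_aB : (a * B <= N ^ 2)%N by rewrite mulnC leq_trunc_div.
have lt_aB : (N ^ 2 < a * B.+1)%N by rewrite mulnC ltn_ceil.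
have sa := sqrt_nat_gt0 R a_gt0; have sB := sqrt_nat_gt0 R B_gt0.
(* The number [N / sqrt a] lies between [sqrt B] and [sqrt (B + 1)]. Thus [d a] is a difference of
   two quantities, each between 0 and [1 / sqrt B]. *)
have d_le : `|d a| <= (s B)^-1.
  have h1 : s B <= N%:R / s a.
    by rewrite ler_pdivlMr // -sqrt_natM mulnC sN ler_sqrt ?ler_nat.
  have h2 : N%:R / s a <= s B.+1.
    by rewrite ler_pdivrMr // -sqrt_natM mulnC sN ler_sqrt ?ler_nat // ltnW.
  have h3 := sqrt_nat_incr_upper R B_gt0.
  have h4 : inv_sqrt_excess R (N ^ 2) <= inv_sqrt_excess R B.
    by rewrite inv_sqrt_excess_noninc // leq_div.
  have h5 : inv_sqrt_excess R B <= inv_sqrt_excess R (N ^ 2) + (s B)^-1.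
    by rewrite inv_sqrt_excess_gap // B_gt0 leq_div.
  have -> : d a = (inv_sqrt_excess R B - g) - 2 * (N%:R / s a - s B).
    by rewrite /d /inv_sqrt_excess -/B; ring.
  by rewrite ler_norml /g; apply/andP; split; lra.
apply: le_trans (ler_norm _) _; rewrite !normrM -mulrA.
apply: le_trans (_ : (s a)^-1 * (s B)^-1 <= _).
  rewrite -[leRHS]mul1r; apply: ler_pM => //; first by rewrite mulr_ge0.
    exact: rchar_norm chiP _.
  have sa1 : 0 <= (s a)^-1 by rewrite invr_ge0 ltW.
  by rewrite (ger0_norm sa1) ler_wpM2l.
rewrite -invfM -sqrt_natM ler_pdivlMr // mulrC ler_pdivrMr; last first.
  by rewrite sqrt_nat_gt0 // muln_gt0 a_gt0.
(* It remains to see [N ^ 2 <= 4 * (a * B)], which follows from [N ^ 2 < a * B + a] and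
   [a <= a * B]. *)
have -> : 2 = s (2 ^ 2) by rewrite -mulnn sqrt_natM -expr2 sqr_sqrt_nat.
rewrite -sqrt_natM sN ler_sqrt ?ler_nat //.
have le_a : (a <= a * B)%N by rewrite leq_pmulr.
by apply: leq_trans (ltnW lt_aB) _; rewrite mulnS; move: le_a; move: (a * B)%N => t; lia.
Qed.

(** Here [a > N] forces [j <= N], so the character sum over [a] is taken first: it is at most
    [K / sqrt (N + 1)], while the sum of [1 / sqrt j] is at most [2 * sqrt N]. *)
Lemma hyperbola_tail N : (0 < N)%N ->
  \sum_(N.+1 <= a < (N ^ 2).+1) chi a * (s a)^-1 * inv_sqrt_sum R (N ^ 2 %/ a) <= 2 * K.
Proof.
move=> N_gt0.
have -> : \sum_(N.+1 <= a < (N ^ 2).+1) chi a * (s a)^-1 * inv_sqrt_sum R (N ^ 2 %/ a) =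
   \sum_(1 <= j < N.+1) (s j)^-1 * \sum_(N.+1 <= a < (N ^ 2 %/ j).+1) chi a * (s a)^-1.
  transitivity (\sum_(N.+1 <= a < (N ^ 2).+1)
      \sum_(1 <= j < N.+1 | (a * j <= N ^ 2)%N) chi a * (s a)^-1 * (s j)^-1).
    apply: eq_big_nat => a /andP[lt_Na _]; rewrite mulr_sumr.
    have a_gt0 : (0 < a)%N by apply: leq_trans lt_Na.
    rewrite (@big_nat_widen _ _ _ _ _ N.+1).
      by apply: eq_bigl => j; rewrite ltnS leq_divRL // mulnC.
    by rewrite ltnS -[leqRHS](mulnK N N_gt0) mulnn leq_div2l // ltnW.
  rewrite (exchange_big_dep_nat xpredT) //=; apply: eq_big_nat => j /andP[j_gt0 _].
  rewrite mulr_sumr [RHS](@big_nat_widen _ _ _ _ _ (N ^ 2).+1); last by rewrite ltnS leq_div.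
  by apply: eq_big => [a|a _]; [rewrite ltnS leq_divRL | rewrite mulrC].
apply: le_trans (_ : \sum_(1 <= j < N.+1) (s j)^-1 * (K * (s N.+1)^-1) <= _).
  apply: ler_sum => j _; rewrite ler_wpM2l ?invr_ge0 ?sqrtr_ge0 //.
  by apply: le_trans (ler_norm _) _; apply: rchar_inv_sqrt_sum.
rewrite -mulr_suml mulrCA [2 * K]mulrC ler_wpM2l ?addr_ge0 // ler_pdivrMr ?sqrt_nat_gt0 //.
have /andP[_] := inv_sqrt_excess_bounds R N; rewrite /inv_sqrt_excess /inv_sqrt_sum subr_le0.
by move=> /le_trans -> //; rewrite ler_wpM2l // ler_sqrt // ler_nat.
Qed.

(** The sum of [divisor_sum chi m / sqrt m] up to [N ^ 2] is bounded below by its terms at squares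
    [m = k ^ 2], and above by the hyperbola method. *)
Lemma harmonic_le_rchar_psum N : (0 < N)%N ->
  \sum_(1 <= k < N.+1) k%:R^-1 <= 2 * N%:R * rchar_psum N + 4 * K + 2.
Proof.
move=> N_gt0.
apply: le_trans (_ : \sum_(1 <= m < (N ^ 2).+1) divisor_sum chi m / s m <= _).
  apply: le_trans (sum_squares_le N (F := fun m => divisor_sum chi m / s m) _); last first.
    by move=> m m_gt0; rewrite mulr_ge0 ?invr_ge0 ?sqrtr_ge0 // (divisor_sum_ge0 chiP).
  apply: ler_sum_nat => k /andP[k_gt0 _].
  rewrite -mulnn sqrt_natM -expr2 sqr_sqrt_nat mulnn ler_peMl ?invr_ge0 //.
  exact: (divisor_sum_square_ge1 chiP).
have -> : \sum_(1 <= m < (N ^ 2).+1) divisor_sum chi m / s m =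
    \sum_(1 <= a < (N ^ 2).+1) chi a * (s a)^-1 * inv_sqrt_sum R (N ^ 2 %/ a).
  transitivity (\sum_(1 <= m < (N ^ 2).+1)
      \sum_(1 <= a < (N ^ 2).+1 | (a %| m)%N) chi a * (s m)^-1).
    apply: eq_big_nat => m /andP[m_gt0]; rewrite ltnS => le_m.
    by rewrite (divisor_sum_widen chi (x := (N ^ 2)%N)) ?m_gt0 // mulr_suml.
  rewrite sum_nat_divisors; apply: eq_bigr => a _; rewrite mulr_sumr.
  by apply: eq_bigr => j _; rewrite sqrt_natM invfM mulrA.
rewrite (@big_cat_nat _ _ _ N.+1) //=; last by rewrite ltnS -mulnn leq_pmull.
by have := hyperbola_head N_gt0; have := hyperbola_tail N_gt0; lra.
Qed.

Lemma harmonic_ge_ln N : ln (N.+1%:R : R) <= \sum_(1 <= k < N.+1) k%:R^-1.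
Proof.
elim: N => [|N IH]; first by rewrite ln1 big_geq.
rewrite (@big_nat_recr _ _ _ N.+1) //=.
have -> : N.+2%:R = N.+1%:R * (1 + N.+1%:R^-1) :> R.
  by rewrite mulrDr mulfV ?pnatr_eq0 // mulr1 natr1.
have V_gt0 : 0 < (N.+1%:R : R)^-1 by rewrite invr_gt0.
have V_gtN1 : -1 < (N.+1%:R : R)^-1 by apply: lt_trans V_gt0; rewrite ltrN10.
rewrite lnM ?posrE ?addr_gt0 //.
by apply: lerD => //; apply: le_ln1Dx.
Qed.

Lemma ln_nat_unbounded (C : R) : exists2 N, (0 < N)%N & C < ln (N%:R : R).
Proof.
exists (Num.truncn (expR C)).+1 => //.
by rewrite -[ltLHS]expRK ltr_ln ?posrE ?expR_gt0 ?ltr0n // truncnS_gt // expR_ge0.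
Qed.

Lemma rchar_psum_bounded_below :
  exists2 c, 0 < c & exists N, forall x, (N <= x)%N -> c <= rchar_psum x.
Proof.
(* This size of [ln N] forces [rchar_psum N >= (K + 1) / N]; later partial sums differ from it by at
   most [K / N], which leaves [1 / N]. *)
have [N N_gt0 ltN] := ln_nat_unbounded (6 * K + 4).
exists (N%:R^-1); first by rewrite invr_gt0 ltr0n.
exists N => x le_Nx.
have := rchar_psum_cauchy le_Nx; rewrite ler_norml => /andP[+ _].
have h1 := harmonic_le_rchar_psum N_gt0; have h2 := harmonic_ge_ln N.
have h3 : ln N%:R <= ln N.+1%:R :> R by rewrite ler_ln ?posrE ?ltr0n ?ler_nat.
have N0 : 0 < N%:R :> R by rewrite ltr0n.
have h4 : K / N.+1%:R <= K / N%:R.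
  by rewrite ler_wpM2l ?addr_ge0 // lef_pV2 ?posrE ?ltr0n ?ler_nat.
have h5 : (K + 1) / N%:R <= rchar_psum N.
  have := lt_le_trans ltN (le_trans h3 (le_trans h2 h1)).
  rewrite ler_pdivrMr // [rchar_psum N * _]mulrC -[2 * _ * _]mulrA.
  by move: (N%:R * _) => t; lra.
move: h4 h5; rewrite [(K + 1) / _]mulrDl mul1r.
by move: (K / N%:R) (K / N.+1%:R) (N%:R^-1) => p q r; clear; lra.
Qed.

End Nonvanishing.

(** * Sums over primes *)

(** The expansion of [(1 + 1) ^ (2 m + 1)] contains this coefficient twice. *)
Lemma bin_mid_le m : ('C(m.*2.+1, m) <= 4 ^ m)%N.
Proof.
rewrite -(@leq_pmul2l 2) // -[X in (_ <= X * _)%N]expn1 (_ : 4 = 2 ^ 2)%N // -expnM -expnD.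
have -> : (1 + 2 * m = m.*2.+1)%N by rewrite mul2n.
rewrite -[X in (_ <= X ^ _)%N]/(1 + 1)%N expnDn.
under eq_bigr do rewrite !exp1n !muln1.
have lt1 : (m < m.*2.+2)%N by rewrite -addnn; lia.
have lt2 : (m.+1 < m.*2.+2)%N by rewrite -addnn; lia.
rewrite (bigD1 (Ordinal lt1)) //= (bigD1 (Ordinal lt2)) /=; last first.
  by rewrite -val_eqE /= gtn_eqF.
have -> : 'C(m.*2.+1, m.+1) = 'C(m.*2.+1, m).
  by rewrite -bin_sub -?addnn; [congr 'C(_, _); lia | lia].
by rewrite mul2n -addnn addnA leq_addr.
Qed.

Lemma prod_primes_dvdn a b n :
  (forall p, (a <= p < b)%N -> prime p -> (p %| n)%N) ->
  (\prod_(a <= p < b | prime p) p %| n)%N.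
Proof.
elim: b => [|b IH] dvd; first by rewrite big_geq // dvd1n.
have [lt_ba|le_ab] := ltnP b a; first by rewrite big_geq // dvd1n.
rewrite big_mkcond big_nat_recr //= -big_mkcond /=.
have IHb : (\prod_(a <= p < b | prime p) p %| n)%N.
  by apply: IH => p /andP[le_ap lt_pb]; apply: dvd; rewrite le_ap ltnW.
case: ifP => [b_pr|_]; last by rewrite muln1.
rewrite Gauss_dvd ?IHb /=; first by apply: dvd; rewrite ?le_ab ?leqnn.
rewrite coprime_sym big_nat_cond; apply: (big_ind (coprime b)); first exact: coprimen1.
  by move=> x y cx cy; rewrite coprimeMr cx.
move=> p /andP[/andP[_ lt_pb] p_pr]; rewrite prime_coprime // dvdn_prime2 //.
by rewrite gtn_eqF.
Qed.

Lemma prime_dvdn_fact p n : prime p -> (p %| n`!)%N = (p <= n)%N.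
Proof.
move=> p_pr; elim: n => [|n IH].
  by rewrite fact0 dvdn1 leqn0 gtn_eqF ?prime_gt1 // gtn_eqF ?prime_gt0.
rewrite factS Euclid_dvdM // IH [RHS]leq_eqVlt ltnS.
have [le_pn|lt_np] := leqP p n; first by rewrite !orbT.
rewrite !orbF; apply/idP/eqP => [dvd|->//].
by apply/eqP; rewrite eqn_leq lt_np dvdn_leq.
Qed.

(** Erdős's induction: for [n = 2 m + 1], the primes above [m + 1] divide ['C(2 m + 1, m)], and an
    even [n > 2] adds no prime. *)
Lemma primorial_le n : (\prod_(1 <= p < n.+1 | prime p) p <= 4 ^ n)%N.
Proof.
elim/ltn_ind: n => n IH.
have [n_le2|n_gt2] := leqP n 2.
  by case: n n_le2 {IH} => [|[|[|]]] // _; rewrite unlock.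
have [n_odd|n_even] := boolP (odd n); last first.
  case: n n_gt2 n_even IH => // n n_gt2 n_even IH.
  rewrite big_mkcond big_nat_recr //= -big_mkcond /= ifN.
    by rewrite muln1 (leq_trans (IH n _)) // leq_pexp2l.
  apply: contra n_even => /even_prime[n2|//]; by rewrite n2 in n_gt2.
have def_n : n = (n./2).*2.+1 by rewrite -[LHS]odd_double_half n_odd.
set m := n./2 in def_n.
rewrite (@big_cat_nat _ _ _ m.+2) //=; last by rewrite def_n -addnn; lia.
apply: leq_trans (_ : 4 ^ m.+1 * 4 ^ m <= _)%N; last first.
  by rewrite -expnD leq_pexp2l // def_n -addnn; lia.
rewrite leq_mul //; first by apply: IH; rewrite def_n -addnn; lia.
apply: leq_trans (bin_mid_le m); rewrite dvdn_leq ?bin_gt0 //; first by rewrite -addnn; lia.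
apply: prod_primes_dvdn => p /andP[gt_m le_n] p_pr.
have le_m : (m <= m.*2.+1)%N by rewrite -addnn; lia.
have := bin_fact le_m; have : (p %| (m.*2.+1)`!)%N.
  by rewrite prime_dvdn_fact // -def_n.
move=> + fact_eq; rewrite -fact_eq !Euclid_dvdM // !prime_dvdn_fact //.
rewrite [(p <= m)%N]leqNgt (leq_trans _ gt_m) //=.
have -> : (m.*2.+1 - m = m.+1)%N by rewrite -addnn; lia.
by rewrite [(p <= _)%N]leqNgt gt_m orbF.
Qed.

Lemma prod_prime_powers m x : (0 < m <= x)%N ->
  (\prod_(1 <= p < x.+1 | prime p) p ^ logn p m)%N = m.
Proof.
move=> /andP[m_gt0 le_mx]; rewrite -[RHS](partnT m_gt0) (widen_partn _ le_mx).
rewrite [RHS]big_ltn_cond //= (lognE 0) /= mul1n big_mkcond /=.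
by apply: eq_bigr => p _; rewrite lognE; case: (prime p).
Qed.

Section PrimeSums.
Variable R : realType.

(** The identity of von Mangoldt, with a range of exponents independent of [m] so that sums can be
    exchanged. *)
Lemma ln_nat_primes m x : (0 < m <= x)%N ->
  ln (m%:R : R) = \sum_(1 <= p < x.+1 | prime p)
                  \sum_(1 <= k < x.+1 | (p ^ k %| m)%N) ln p%:R.
Proof.
move=> /andP[m_gt0 le_mx].
have -> : ln (m%:R : R) = \sum_(1 <= p < x.+1 | prime p) ln p%:R *+ logn p m.
  have ln_prod (r : seq nat) (e : nat -> nat) :
    (0 < \prod_(p <- r | prime p) p ^ e p)%N /\
    ln (\prod_(p <- r | prime p) p ^ e p)%:R = \sum_(p <- r | prime p) ln p%:R *+ e p :> R.
    apply: (big_rec2 (fun y z => (0 < y)%N /\ ln y%:R = z :> R)); first by rewrite ln1.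
    move=> p y z p_pr [y_gt0 <-]; have p_gt0 := prime_gt0 p_pr.
    split; first by rewrite muln_gt0 expn_gt0 p_gt0.
    by rewrite natrM lnM ?posrE ?ltr0n ?expn_gt0 ?p_gt0 // natrX lnXn ?ltr0n.
  by rewrite -(ln_prod _ (logn^~ m)).2 prod_prime_powers ?m_gt0.
apply: eq_bigr => p p_pr; rewrite logn_count_dvd // -sumrMnr big_mkcond /=.
rewrite [RHS](@big_cat_nat _ _ _ m) //=; last by rewrite ltnW.
rewrite [X in _ + X]big_nat_cond [X in _ + X]big1 ?addr0; last first.
  move=> k /andP[/andP[le_mk _] /(dvdn_leq m_gt0)].
  by rewrite leqNgt (leq_ltn_trans le_mk) // ltn_expl // prime_gt1.
by rewrite [RHS]big_mkcond; apply: eq_bigr => k _; case: (_ %| _)%N.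
Qed.

(** Applied with [F = 1] to obtain divergence, and with [F m = chi m / m] for the character sum. *)
Lemma sum_ln_primes (F : nat -> R) x :
  \sum_(1 <= m < x.+1) F m * ln m%:R =
  \sum_(1 <= p < x.+1 | prime p) \sum_(1 <= k < x.+1)
     ln p%:R * \sum_(1 <= j < (x %/ p ^ k).+1) F (p ^ k * j)%N.
Proof.
transitivity (\sum_(1 <= m < x.+1) \sum_(1 <= p < x.+1 | prime p)
    \sum_(1 <= k < x.+1 | (p ^ k %| m)%N) F m * ln p%:R).
  apply: eq_big_nat => m /andP[m_gt0]; rewrite ltnS => le_mx.
  rewrite (@ln_nat_primes m x) ?m_gt0 // mulr_sumr; apply: eq_bigr => p _.
  by rewrite mulr_sumr.
rewrite exchange_big_nat /=; apply: eq_bigr => p p_pr.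
rewrite (exchange_big_dep_nat xpredT) //=; apply: eq_bigr => k _.
rewrite sum_nat_multiples ?expn_gt0 ?prime_gt0 // mulr_sumr.
by apply: eq_bigr => j _; rewrite mulrC.
Qed.

Lemma sum_ln_prime_le x : \sum_(1 <= p < x.+1 | prime p) ln (p%:R : R) <= x%:R * ln 4.
Proof.
have -> : \sum_(1 <= p < x.+1 | prime p) ln (p%:R : R) =
    ln (\prod_(1 <= p < x.+1 | prime p) p)%:R.
  suff [] : (0 < \prod_(1 <= p < x.+1 | prime p) p)%N /\
    \sum_(1 <= p < x.+1 | prime p) ln (p%:R : R) = ln (\prod_(1 <= p < x.+1 | prime p) p)%:R by [].
  apply: (big_rec2 (fun z y => (0 < y)%N /\ z = ln y%:R :> R)); first by rewrite ln1.
  move=> p y z p_pr [y_gt0 ->]; have p_gt0 := prime_gt0 p_pr.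
  by rewrite muln_gt0 p_gt0 natrM lnM ?posrE ?ltr0n.
have pos : (0 < \prod_(1 <= p < x.+1 | prime p) p)%N.
  by rewrite prodn_cond_gt0 // => p /prime_gt0.
rewrite mulr_natl -lnXn ?ltr0n // -natrX ler_ln ?posrE ?ltr0n ?expn_gt0 // ler_nat.
exact: primorial_le.
Qed.

Lemma sum_geometric_le p n : (1 < p)%N ->
  \sum_(2 <= k < n) ((p ^ k)%N%:R^-1 : R) <= 2 / (p ^ 2)%N%:R.
Proof.
move=> p_gt1; have p2 : 2 <= p%:R :> R by rewrite ler_nat.
have p0 : 0 < p%:R :> R by lra.
have [n_le|n_gt] := leqP n 2; first by rewrite big_geq // divr_ge0.
(* The subtracted term makes the induction work: [2 / p ^ n <= 1 / p ^ (n - 1)] because [p >= 2]. *)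
suff : \sum_(2 <= k < n) ((p ^ k)%N%:R^-1 : R) <= 2 / (p ^ 2)%N%:R - (p ^ n.-1)%N%:R^-1.
  by move=> /le_trans; apply; rewrite gerBl invr_ge0.
elim: n n_gt => // n IH; rewrite ltnS leq_eqVlt => /orP[/eqP <-|n_gt] /=.
  by rewrite big_nat1; lra.
rewrite (@big_nat_recr _ _ _ n) //=; last exact: ltnW.
apply: le_trans (lerD (IH n_gt) (lexx _)) _.
case: n n_gt {IH} => // n _ /=; rewrite (expnS p n) (natrM _ p) (invfM p%:R).
have y0 : 0 <= ((p ^ n)%:R : R)^-1 by rewrite invr_ge0.
have : (p%:R : R)^-1 <= 2^-1 by rewrite lef_pV2 ?posrE.
by move: y0; move: ((p ^ n)%:R^-1) (p%:R^-1) (2 / _) => y z t; clear; nra.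
Qed.

(** The bound is chosen to telescope. With [u = sqrt (p - 1)] and [v = sqrt p], one has
    [ln p = 2 * ln v <= 2 * v] and [1/u - 1/v = 1 / (u v (u + v)) >= 1 / (2 v ^ 3)]. *)
Lemma ln_div_sqr_le p : (1 < p)%N ->
  ln (p%:R : R) / (p ^ 2)%N%:R <= 4 * ((Num.sqrt p.-1%:R)^-1 - (Num.sqrt p%:R)^-1).
Proof.
case: p => [|[|p]] // _; rewrite [p.+2.-1]/=.
have u0 := @sqrt_nat_gt0 R p.+1 isT; have v0 := @sqrt_nat_gt0 R p.+2 isT.
have uE := sqr_sqrt_nat R p.+1.
have vE : Num.sqrt (p.+2%:R : R) ^+ 2 = p.+1%:R + 1 by rewrite sqr_sqrt_nat natr1.
have uv : Num.sqrt (p.+1%:R : R) <= Num.sqrt p.+2%:R by rewrite ler_sqrt ?ler_nat.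
rewrite natrX -[in ln _](sqr_sqrt_nat R p.+2) lnXn // -[in (_ ^+ 2)^-1](sqr_sqrt_nat R p.+2).
have := ln_sublinear v0; move: u0 v0 uE vE uv.
move: (p.+1%:R) (Num.sqrt p.+1%:R) (Num.sqrt p.+2%:R) => t u v u0 v0 uE vE uv lnv.
have vu : v ^+ 2 - u ^+ 2 = 1 by rewrite uE vE; ring.
have -> : u^-1 - v^-1 = (u * v * (u + v))^-1.
  rewrite -[RHS]mul1r -vu; field.
  by rewrite !gt_eqF ?addr_gt0.
rewrite ler_pdivrMr ?exprn_gt0 // mulrAC ler_pdivlMr ?mulr_gt0 ?addr_gt0 //.
apply: le_trans (_ : v *+ 2 * (u * v * (u + v)) <= _).
  have uv0 : 0 <= u * v * (u + v) by rewrite ltW // !mulr_gt0 // addr_gt0.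
  by rewrite ler_wpM2r // lerMn2r ltW.
have h : u * v * (u + v) <= 2 * v ^+ 3 by nra.
have : v *+ 2 * (u * v * (u + v)) <= v *+ 2 * (2 * v ^+ 3).
  by rewrite ler_wpM2l // mulrn_wge0 // ltW.
by move=> /le_trans; apply; rewrite le_eqVlt; apply/orP; left; apply/eqP; ring.
Qed.

(** The geometric sum gives a factor 2, [ln_div_sqr_le] a factor 4, and the telescoping sum is at
    most 1. *)
Lemma sum_prime_powers_le x :
  \sum_(1 <= p < x.+1 | prime p) \sum_(2 <= k < x.+1) ln (p%:R : R) / (p ^ k)%N%:R <= 8.
Proof.
apply: le_trans (_ : \sum_(2 <= p < x.+1)
    8 * ((Num.sqrt (p.-1%:R : R))^-1 - (Num.sqrt p%:R)^-1) <= _).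
  rewrite big_mkcond [leRHS](_ : _ = \sum_(1 <= p < x.+1) (if (1 < p)%N then
      8 * ((Num.sqrt (p.-1%:R : R))^-1 - (Num.sqrt p%:R)^-1) else 0)).
    apply: ler_sum_nat => p /andP[p_gt0 _]; case: ifP => [p_pr|_].
      rewrite prime_gt1 // -mulr_sumr.
      apply: le_trans (_ : ln p%:R * (2 / (p ^ 2)%N%:R) <= _).
        by rewrite ler_wpM2l ?ln_ge0 ?ler1n // sum_geometric_le // prime_gt1.
      have := ln_div_sqr_le (prime_gt1 p_pr).
      by rewrite mulrCA; move: (ln _ / _) (_^-1 - _) => y z; lra.
    case: ifP => // p_gt1; rewrite mulr_ge0 // subr_ge0 lef_pV2 ?posrE ?sqrt_nat_gt0 //.
      by rewrite ler_sqrt // ler_nat leq_pred.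
    by rewrite -subn1 subn_gt0.
  have [->|x_gt0] := posnP x; first by rewrite !big_geq.
  by rewrite [RHS]big_ltn //= add0r; apply: eq_big_nat => p /andP[->].
have [x_le1|x_gt1] := leqP x 1; first by rewrite big_geq.
rewrite -mulr_sumr big_add1 /= (@telescope_sumr_eq _ _ _ (fun k => - (Num.sqrt (k%:R : R))^-1)).
- rewrite sqrtr1 invr1 opprK addrC ler_piMr // gerBl invr_ge0 sqrtr_ge0 //.
- exact: ltnW.
- by move=> k _; rewrite opprK addrC.
Qed.
End PrimeSums.

Lemma sum_ln_ge (R : realType) x :
  x%:R * ln (x%:R : R) - x%:R <= \sum_(1 <= m < x.+1) ln m%:R.
Proof.
elim: x => [|x IH]; first by rewrite mul0r subr0 big_geq.
rewrite big_nat_recr //=; case: (posnP x) => [->|x_gt0].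
  by rewrite big_geq // ln1 mulr0 addr0 sub0r oppr_le0.
have x0 : 0 < x%:R :> R by rewrite ltr0n.
have h : ln (x.+1%:R : R) - ln x%:R <= x%:R^-1.
  rewrite -ln_div ?posrE ?ltr0n // -natr1 mulrDl mulfV ?gt_eqF // mul1r.
  by apply: le_ln1Dx; apply: lt_trans (_ : 0 < _); rewrite ?ltrN10 ?invr_gt0.
have {}h : x%:R * (ln (x.+1%:R : R) - ln x%:R) <= 1 by rewrite mulrC -ler_pdivlMr // div1r.
apply: le_trans (lerD IH (lexx _)).
have -> : x.+1%:R * ln x.+1%:R - x.+1%:R =
   x%:R * ln (x.+1%:R : R) + ln (x.+1%:R : R) - x%:R - 1.
  by rewrite -[X in X * _]natr1 -[X in _ - X]natr1; ring.
by move: h; move: (x%:R) (ln x%:R) (ln x.+1%:R) => t b a; nra.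
Qed.

(** Mertens' argument: compare [x * ln x - x] with the prime expansion of the logarithm of [x]
    factorial. In [C + 9], 8 pays for the higher prime powers and 1 for the term [- x]. *)
Lemma sum_prime_ln_unbounded (R : realType) (C : R) :
  exists N, forall x, (N <= x)%N ->
    C <= \sum_(1 <= p < x.+1 | prime p) ln (p%:R : R) / p%:R.
Proof.
have [N N_gt0 ltN] := ln_nat_unbounded (C + 9); exists N => x le_Nx.
have x_gt0 : (0 < x)%N by apply: leq_trans le_Nx.
have x0 : 0 < x%:R :> R by rewrite ltr0n.
have lnx : C + 9 < ln (x%:R : R).
  by apply: lt_le_trans ltN _; rewrite ler_ln ?posrE ?ltr0n ?ler_nat.
have up : \sum_(1 <= m < x.+1) ln (m%:R : R) <=
    x%:R * (\sum_(1 <= p < x.+1 | prime p) ln (p%:R : R) / p%:R + 8).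
  have := sum_ln_primes (fun=> 1 : R) x.
  under eq_bigr do rewrite mul1r.
  move=> ->.
  apply: le_trans (_ : x%:R * \sum_(1 <= p < x.+1 | prime p)
      \sum_(1 <= k < x.+1) ln (p%:R : R) / (p ^ k)%N%:R <= _).
    rewrite mulr_sumr; apply: ler_sum => p p_pr; rewrite mulr_sumr; apply: ler_sum => k _.
    rewrite sumr_const_nat subn1 /= mulrCA ler_wpM2l ?ln_ge0 ?ler1n ?prime_gt0 //.
    rewrite ler_pdivlMr ?ltr0n ?expn_gt0 ?prime_gt0 // -natrM ler_nat.
    exact: leq_trunc_div.
  rewrite ler_wpM2l // -[leRHS]addrC; apply: le_trans (lerD (sum_prime_powers_le R x) (lexx _)).
  rewrite -big_split /=; apply: ler_sum => p p_pr.
  by rewrite big_ltn // expn1 addrC.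
have lo := sum_ln_ge R x.
have : x%:R * (ln x%:R - 1) <= x%:R * (\sum_(1 <= p < x.+1 | prime p) ln (p%:R : R) / p%:R + 8).
  by apply: le_trans up; rewrite mulrBr mulr1.
rewrite ler_pM2l //; lra.
Qed.

(** * Character sums over primes *)

Section CharacterPrimeSum.
Variables (R : realType) (M : nat) (chi : nat -> R).
Hypothesis chiP : real_char M chi.
Hypothesis M_gt0 : (0 < M)%N.
Hypothesis chiN : exists2 c, coprime c M & chi c != 1.
Local Notation K := (M%:R + M%:R : R).

Lemma rchar_ln_sum_bounded :
  exists C : R, exists N, forall x, (N <= x)%N ->
    `|\sum_(1 <= m < x.+1) chi m / m%:R * ln m%:R| <= C.
Proof.
(* The weight [ln m / m] is known to decrease once [ln m >= 1], so a finite initial segment is split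
   off. *)
have [N N_gt0 ltN] := ln_nat_unbounded (1 : R).
exists (`|\sum_(1 <= m < N) chi m / m%:R * ln m%:R| + K * (ln N%:R / N%:R)).
exists N => x le_Nx.
rewrite (@big_cat_nat _ _ _ N) //=; last exact: leqW.
apply: le_trans (ler_normD _ _) _; rewrite lerD2l.
under eq_bigr do rewrite mulrAC -mulrA.
apply: (@rchar_weighted_sum R M chi _ _ _ _ _ (fun m => ln m%:R / m%:R)) => //; last first.
  by move=> i le_Ni; rewrite divr_ge0 // ln_ge0 // ler1n (leq_trans N_gt0).
move=> i le_Ni; have i_gt0 : (0 < i)%N by apply: leq_trans le_Ni.
have i0 : 0 < i%:R :> R by rewrite ltr0n.
have lni : 1 <= ln (i%:R : R).
  by apply: le_trans (ltW ltN) _; rewrite ler_ln ?posrE ?ltr0n ?ler_nat.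
have h : ln (i.+1%:R : R) - ln i%:R <= i%:R^-1.
  rewrite -ln_div ?posrE ?ltr0n // -natr1 mulrDl mulfV ?gt_eqF // mul1r.
  by apply: le_ln1Dx; apply: lt_trans (_ : 0 < _); rewrite ?ltrN10 ?invr_gt0.
have {}h : i%:R * (ln (i.+1%:R : R) - ln i%:R) <= 1 by rewrite mulrC -ler_pdivlMr // div1r.
rewrite ler_pdivrMr ?ltr0n // mulrAC ler_pdivlMr // -[X in _ <= _ * X]natr1.
by move: h lni; move: (i%:R) (ln i%:R) (ln i.+1%:R) => t b a; nra.
Qed.

(** Expanding [ln m] over prime powers writes a bounded sum as [P x * A + D + E]. Replacing
    [P (x %/ p)] by [P x] costs at most [K * p / x], so Chebyshev's bound controls [D]; the higher
    powers form [E]. Dividing by [P x >= c > 0] bounds [A]. *)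
Lemma rchar_prime_sum_bounded :
  exists C : R, exists N, forall x, (N <= x)%N ->
    `|\sum_(1 <= p < x.+1 | prime p) chi p * (ln p%:R / p%:R)| <= C.
Proof.
have [C [N1 hC]] := rchar_ln_sum_bounded.
have [c c_gt0 [N2 hc]] := rchar_psum_bounded_below chiP M_gt0 chiN.
have K_ge0 : 0 <= K by rewrite addr_ge0.
exists ((C + K * ln 4 + 8 * K) / c); exists (maxn 1 (maxn N1 N2)) => x.
rewrite !geq_max => /and3P[x_gt0 le1 le2].
have x0 : 0 < x%:R :> R by rewrite ltr0n.
set A := \sum_(_ <= _ < _ | _) _.
set P := rchar_psum chi.
have cP : c <= P x by apply: hc.
suff bound : `|P x * A| <= C + K * ln 4 + 8 * K.
  rewrite ler_pdivlMr // mulrC (le_trans _ bound) // normrM ler_wpM2r //.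
  exact: le_trans cP (ler_norm _).
have pexp : \sum_(1 <= m < x.+1) chi m / m%:R * ln m%:R =
    \sum_(1 <= p < x.+1 | prime p) \sum_(1 <= k < x.+1)
      ln p%:R / (p ^ k)%N%:R * (chi p ^+ k * P (x %/ p ^ k)%N).
  rewrite sum_ln_primes; apply: eq_bigr => p p_pr; apply: eq_bigr => k _.
  rewrite -!mulrA; congr (_ * _); rewrite /P /rchar_psum !mulr_sumr.
  apply: eq_bigr => j _; rewrite (rcharM chiP) (rcharX chiP) natrM invfM.
  by ring.
set E := \sum_(1 <= p < x.+1 | prime p) \sum_(2 <= k < x.+1)
      ln p%:R / (p ^ k)%N%:R * (chi p ^+ k * P (x %/ p ^ k)%N).
set D := \sum_(1 <= p < x.+1 | prime p) chi p * (ln p%:R / p%:R) * (P (x %/ p)%N - P x).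
have split_sum : \sum_(1 <= m < x.+1) chi m / m%:R * ln m%:R = P x * A + D + E.
  rewrite pexp /A /D /E mulr_sumr -!big_split /=; apply: eq_bigr => p p_pr.
  by rewrite big_ltn // expn1 expr1; ring.
have chiX p k : `|chi p ^+ k| <= 1 by rewrite -(rcharX chiP) (rchar_norm chiP).
have E_le : `|E| <= 8 * K.
  apply: le_trans (ler_norm_sum _ _ _) _.
  apply: le_trans (ler_wpM2r K_ge0 (sum_prime_powers_le R x)).
  rewrite mulr_suml; apply: ler_sum => p p_pr.
  apply: le_trans (ler_norm_sum _ _ _) _.
  rewrite mulr_suml; apply: ler_sum => k _.
  have w0 : 0 <= ln p%:R / (p ^ k)%N%:R :> R by rewrite divr_ge0 // ln_ge0 // ler1n prime_gt0.
  rewrite normrM (ger0_norm w0) ler_wpM2l // normrM -[leRHS]mul1r ler_pM //.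
  exact: rchar_psum_le.
have D_le : `|D| <= K * ln 4.
  apply: le_trans (ler_norm_sum _ _ _) _.
  apply: le_trans (_ : \sum_(1 <= p < x.+1 | prime p) ln p%:R * (K / x%:R) <= _); last first.
    rewrite -mulr_suml mulrCA ler_wpM2l // ler_pdivrMr // mulrC.
    exact: sum_ln_prime_le.
  apply: ler_sum => p p_pr; have p_gt0 := prime_gt0 p_pr.
  have l0 : 0 <= ln p%:R :> R by rewrite ln_ge0 // ler1n.
  rewrite !normrM -mulrA -[leRHS]mul1r ler_pM ?mulr_ge0 // ?(rchar_norm chiP) //.
  rewrite (ger0_norm l0) -mulrA ler_wpM2l // distrC.
  have q0 : 0 < (x %/ p).+1%:R :> R by rewrite ltr0n.
  have p0 : 0 < p%:R :> R by rewrite ltr0n.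
  apply: le_trans (_ : p%:R^-1 * (K / (x %/ p).+1%:R) <= _).
    have pV0 : 0 <= (p%:R : R)^-1 by rewrite invr_ge0 ltW.
    rewrite (ger0_norm pV0) ler_wpM2l //.
    by apply: rchar_psum_cauchy => //; apply: leq_div.
  rewrite mulrCA ler_wpM2l // -invfM lef_pV2 ?posrE ?mulr_gt0 // -natrM ler_nat.
  by rewrite mulnC ltnW // ltn_ceil.
have := hC x le1; rewrite split_sum => W_le.
have -> : P x * A = (P x * A + D + E) - D - E by ring.
apply: le_trans (ler_normB _ _) _; apply: lerD => //.
by apply: le_trans (ler_normB _ _) _; apply: lerD.
Qed.

End CharacterPrimeSum.

(** * Primes with prescribed values of real characters *)

Lemma real_char_prod (R : realType) (I : finType) (M : nat) (chi : I -> nat -> R) (S : {set I}) :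
  (forall i, real_char M (chi i)) -> real_char M (fun m => \prod_(i in S) chi i m).
Proof.
move=> chiP; split.
- by apply: big1 => i _; apply: rchar1 (chiP i).
- by move=> a b; rewrite -big_split; apply: eq_bigr => i _; apply: rcharM (chiP i) _ _.
- by move=> a; apply: eq_bigr => i _; apply: rchar_period (chiP i) _.
- by move=> a; rewrite -prodrXl; apply: eq_bigr => i _; apply: rchar_cube (chiP i) _.
Qed.

(* The weight [\prod_i (1 + eps i * chi i p)] vanishes unless [chi i p <> - eps i]
   for all [i]; expanding it over subsets of [I], every term but the empty one is a
   nonprincipal character and contributes a bounded amount to the divergent sum. *)
Lemma prime_prescribed_characters (R : realType) (I : finType) (M : nat)
    (chi : I -> nat -> R) (eps : I -> R) (B : nat) :
  (0 < M)%N -> (forall i, real_char M (chi i)) ->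
  (forall i, exists c, [/\ coprime c M, chi i c = -1 & forall j, j != i -> chi j c = 1]) ->
  exists p, [/\ prime p, (B < p)%N & forall i, 1 + eps i * chi i p != 0].
Proof.
move=> M_gt0 chiP indep.
pose A (S : {set I}) x : R := \sum_(1 <= p < x.+1 | prime p) (\prod_(i in S) chi i p) * (ln p%:R / p%:R).
(* Quantifying over every [S], with dummy constants for the empty set, lets [fin_all_exists] choose
   all the bounds at once. *)
have bounded (S : {set I}) : exists CN : R * nat,
    S != set0 -> forall x, (CN.2 <= x)%N -> `|A S x| <= CN.1.
  have [->|[i iS]] := set_0Vmem S; first by exists (0, 0%N); rewrite eqxx.
  have [c [coc chic chij]] := indep i.
  have nonprincipal : exists2 c, coprime c M & \prod_(i in S) chi i c != 1.
    exists c => //; rewrite (bigD1 i) //= chic big1 ?mulr1.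
      by rewrite lt_eqF //; lra.
    by move=> j /andP[_ /chij].
  have [C [N hC]] := rchar_prime_sum_bounded (real_char_prod S chiP) M_gt0 nonprincipal.
  by exists (C, N).
have {bounded}[CN hCN] := fin_all_exists bounded.
pose w p := \prod_i (1 + eps i * chi i p).
pose W x := \sum_(1 <= p < x.+1 | prime p) w p * (ln p%:R / p%:R).
have W_expand x : W x = \sum_(S : {set I}) (\prod_(i in S) eps i) * A S x.
  rewrite /W /A; under [RHS]eq_bigr do rewrite mulr_sumr.
  rewrite exchange_big /=; apply: eq_bigr => p p_pr.
  rewrite /w; under eq_bigr do rewrite addrC.
  rewrite bigA_distr mulr_suml; apply: eq_bigr => S _; rewrite [RHS]mulrA; congr (_ * _).
  by rewrite -big_split /= [RHS]big_mkcond.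
pose C := \sum_(S : {set I} | S != set0) `|\prod_(i in S) eps i| * (CN S).1.
pose N := \max_(S : {set I}) (CN S).2.
have W_ge x : (N <= x)%N -> A set0 x - C <= W x.
  move=> le_Nx; rewrite W_expand (bigD1 set0) //= big_set0 mul1r lerD2l.
  rewrite lerNl -sumrN; apply: ler_sum => S S_neq0; rewrite -mulrN.
  apply: le_trans (ler_norm _) _; rewrite normrM normrN ler_wpM2l //.
  by apply: hCN => //; apply: leq_trans le_Nx; apply: leq_bigmax.
(* Far enough out the main term exceeds [C + W B], so [W x > W B] and some prime above [B] has
   nonzero weight. *)
have [N' hN'] := sum_prime_ln_unbounded (C + W B + 1).
pose x := maxn B (maxn N N').
have lt_W : W B < W x.
  have := W_ge x _; rewrite leq_max leq_max leqnn orbT => /(_ isT).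
  have -> : A set0 x = \sum_(1 <= p < x.+1 | prime p) ln (p%:R : R) / p%:R.
    by apply: eq_bigr => p _; rewrite big_set0 mul1r.
  have := hN' x; rewrite !leq_max leqnn !orbT => /(_ isT); lra.
have : has (fun p => prime p && (w p != 0)) (index_iota B.+1 x.+1).
  apply: contraTT lt_W => /hasPn none; rewrite -leNgt.
  rewrite /W (@big_cat_nat _ _ _ B.+1 1 x.+1) //=; last by rewrite ltnS leq_maxl.
  rewrite gerDl big_seq_cond big1 // => p /andP[/none + p_pr].
  by rewrite p_pr negbK => /eqP ->; rewrite mul0r.
case/hasP => p; rewrite mem_index_iota => /andP[lt_Bp _] /andP[p_pr].
by rewrite /w => /prodf_neq0 w_neq0; exists p; split=> // i; apply: w_neq0.
Qed.

(** * Quadratic residues *)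

(** Euler's criterion taken as definition, as [p./2 = (p - 1) / 2] for odd [p]. Integer values allow
    symbols for different primes to be compared. *)
Definition legendre (p : nat) (x : 'F_p) : int :=
  if x == 0 then 0 else if x ^+ p./2 == 1 then 1 else -1.

Section Legendre.
Variable p : nat.
Hypothesis p_pr : prime p.
Hypothesis p_gt2 : (2 < p)%N.

Lemma odd_prime_half : p = (p./2).*2.+1.
Proof.
have p_odd : odd p by case: (even_prime p_pr) => // p2; have := p_gt2; rewrite p2.
by rewrite -[LHS]odd_double_half p_odd.
Qed.

Lemma odd_prime_half_gt0 : (0 < p./2)%N.
Proof. by rewrite half_gt0 ltnW. Qed.

Lemma expr_odd_prime (R : pzSemiRingType) (x : R) : x ^+ p = x * x ^+ p./2.*2.
Proof. by rewrite {1}odd_prime_half exprS. Qed.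

Lemma Fp_expfp (x : 'F_p) : x ^+ p = x.
Proof. by rewrite -[X in _ ^+ X](card_Fp p_pr) expf_card. Qed.

Lemma Fp_euler (x : 'F_p) : x != 0 -> (x ^+ p./2 == 1) || (x ^+ p./2 == -1).
Proof.
move=> x_neq0; rewrite -sqrf_eq1 -exprM muln2.
apply/eqP/(mulfI x_neq0); by rewrite -expr_odd_prime Fp_expfp mulr1.
Qed.

(** Since [p > 2], the values -1, 0 and 1 stay distinct in characteristic [p], so signs can be read
    off in [K]. *)
Lemma pchar_intr_inj (K : fieldType) (a b : int) : p \in [pchar K] ->
  (`|a| <= 1)%R -> (`|b| <= 1)%R -> a%:~R = b%:~R :> K -> a = b.
Proof.
move=> pK; rewrite !ler_norml => /andP[a1 a2] /andP[b1 b2] /eqP.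
rewrite -subr_eq0 -rmorphB /= -(dvdz_pcharf pK) => /dvdzP[c abc].
have c0 : c = 0.
  have [c_lt|c_gt|//] := ltgtP c 0; have : 3 <= p%:Z by lia.
    by nia.
  by nia.
by move: abc; rewrite c0 mul0r; lia.
Qed.

Lemma legendre_norm (x : 'F_p) : `|legendre x| <= 1.
Proof. by rewrite /legendre; case: ifP => // _; case: ifP. Qed.

Lemma legendreE (x : 'F_p) : (legendre x)%:~R = x ^+ p./2.
Proof.
rewrite /legendre; have [->|x_neq0] := eqVneq x 0; first by rewrite expr0n gtn_eqF ?odd_prime_half_gt0.
by case: eqP => [->|/eqP nx] //; move: (Fp_euler x_neq0); rewrite (negbTE nx) => /eqP ->.
Qed.

Lemma legendre_unique (x : 'F_p) (a : int) : `|a| <= 1 -> a%:~R = x ^+ p./2 -> legendre x = a.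
Proof.
move=> a1 ax; apply: (pchar_intr_inj (pchar_Fp p_pr)) => //; first exact: legendre_norm.
by rewrite legendreE.
Qed.

Lemma legendre1 : legendre (1 : 'F_p) = 1.
Proof. by apply: legendre_unique; rewrite ?expr1n. Qed.

Lemma legendreM (x y : 'F_p) : legendre (x * y) = legendre x * legendre y.
Proof.
apply: legendre_unique; last by rewrite rmorphM /= !legendreE exprMn.
by rewrite normrM mulr_ile1 // legendre_norm.
Qed.

Lemma legendre_neq0 (x : 'F_p) : x != 0 -> legendre x ^+ 2 = 1.
Proof. by move=> x0; rewrite /legendre (negbTE x0); case: ifP. Qed.

Lemma legendre_eq0 (x : 'F_p) : (legendre x == 0) = (x == 0).
Proof. by rewrite /legendre; case: ifP => // _; case: ifP. Qed.

Lemma legendre_exp_odd (x : 'F_p) k : odd k -> legendre x ^+ k = legendre x.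
Proof.
move=> k_odd; rewrite -(odd_double_half k) k_odd -muln2 mulnC exprD exprM.
have [->|x0] := eqVneq x 0; last by rewrite legendre_neq0 // expr1n mulr1.
by rewrite /legendre eqxx expr1 mul0r.
Qed.

(** Otherwise [X ^ (p./2) - 1] would have all [p - 1] nonzero elements as roots. *)
Lemma legendre_nonresidue : exists x : 'F_p, legendre x = -1.
Proof.
have [/existsP[x /eqP]|] := boolP [exists x : 'F_p, legendre x == -1]; first by exists x.
rewrite negb_exists => /forallP none.
pose rs := [seq x <- enum 'F_p | x != 0].
have P_neq0 : 'X^(p./2) - 1%:P != 0 :> {poly 'F_p}.
  by rewrite -size_poly_eq0 size_XnsubC ?odd_prime_half_gt0.
have := max_poly_roots P_neq0 (rs := rs); rewrite size_XnsubC ?odd_prime_half_gt0 //.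
have -> : size rs = p.-1.
  rewrite size_filter -[RHS](congr1 predn (card_Fp p_pr)) [#|_|](cardD1 0) inE /=.
  by rewrite cardE -size_filter /enum_mem -filter_predI -enumT; apply/eqP;
    rewrite size_filter; apply/eqP; apply: eq_count => x; rewrite !inE andbT.
rewrite filter_uniq ?enum_uniq // => h.
have /h/(_ isT) : all (root ('X^(p./2) - 1%:P : {poly 'F_p})) rs.
  apply/allP => x; rewrite mem_filter => /andP[x_neq0 _].
  rewrite rootE !hornerE subr_eq0.
  by have := none x; rewrite /legendre (negbTE x_neq0); case: ifP.
by rewrite {1}odd_prime_half /= -addnn; have := odd_prime_half_gt0; lia.
Qed.

Lemma sum_legendre : \sum_(x : 'F_p) legendre x = 0.
Proof.
have [c c_nr] := legendre_nonresidue.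
have c0 : c != 0 by rewrite -legendre_eq0 c_nr.
have : \sum_(x : 'F_p) legendre x = - \sum_(x : 'F_p) legendre x.
  rewrite {1}(reindex_inj (mulfI c0)) /= -mulN1r mulr_sumr.
  by apply: eq_bigr => x _; rewrite legendreM c_nr.
by lia.
Qed.

Section Extension.
Variables (K : fieldType) (f : {rmorphism 'F_p -> K}).

Lemma pchar_extension : p \in [pchar K].
Proof. by rewrite (fmorph_pchar f) pchar_Fp. Qed.

Lemma sqrt_expp (x : 'F_p) (g : K) : g ^+ 2 = f x -> g ^+ p = (legendre x)%:~R * g.
Proof.
move=> g2; rewrite expr_odd_prime -mul2n exprM g2 -rmorphXn -legendreE.
by rewrite rmorph_int mulrC.
Qed.

(** The method for computing symbols below: exhibit a square root in an extension field and apply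
    Frobenius to it. *)
Lemma legendre_sqrt (x : 'F_p) (g : K) (a : int) : g != 0 -> `|a| <= 1 ->
  g ^+ 2 = f x -> g ^+ p = a%:~R * g -> legendre x = a.
Proof.
move=> g_neq0 a1 g2 gp; apply: (pchar_intr_inj pchar_extension) => //.
  exact: legendre_norm.
by apply: (mulIf g_neq0); rewrite -gp -sqrt_expp.
Qed.

Lemma frobenius_fixed (g : K) : g ^+ p = g -> exists x, g = f x.
Proof.
move=> gp; have := congr1 (map_poly f) (finField_genPoly 'F_p).
rewrite (card_Fp p_pr) rmorphB /= map_polyXn map_polyX rmorph_prod /=.
move=> /(congr1 (fun P => P.[g])); rewrite !hornerE gp subrr horner_prod.
move=> /esym/eqP /prodf_eq0[x _]; rewrite rmorphB /= map_polyX map_polyC !hornerE subr_eq0.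
by move=> /eqP ->; exists x.
Qed.
End Extension.

(** A square root exists in an algebraic closure; symbol 1 makes Frobenius fix it, so it lies in the
    prime field. *)
Lemma legendre_square (x : 'F_p) : legendre x = 1 -> exists y, y ^+ 2 = x.
Proof.
move=> x1; have [K [f _]] := countable_algebraic_closure 'F_p.
have [g g2] := @solve_monicpoly K 2 (fun i => if i == 0%N then f x else 0) isT.
have {}g2 : g ^+ 2 = f x.
  by rewrite g2 !big_ord_recl big_ord0 /= expr0 mulr1 mul0r !addr0.
have gp := sqrt_expp g2; rewrite x1 mul1r in gp.
have [y gy] := frobenius_fixed f gp; exists y.
by apply: (fmorph_inj f); rewrite rmorphXn /= -gy.
Qed.

Lemma legendreN1 : legendre (-1 : 'F_p) = if (p %% 4 == 1)%N then 1 else -1.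
Proof.
have p_odd := odd_prime_half.
apply: legendre_unique; first by case: ifP.
rewrite -signr_odd; case: ifP => /eqP p4.
  have -> : odd p./2 = false by apply/negbTE/negP => h; lia.
  by rewrite expr0.
have -> : odd p./2 by lia.
by rewrite expr1.
Qed.

Lemma eighth_root (K : closedFieldType) : exists2 z : K, z ^+ 4 = -1 & z ^+ 8 = 1.
Proof.
have [z z4] := @solve_monicpoly K 4 (fun i => if i == 0%N then -1 else 0) isT.
have {}z4 : z ^+ 4 = -1.
  by rewrite z4 !big_ord_recl big_ord0 /= expr0 mulr1 !mul0r !addr0.
by exists z => //; rewrite -[8%N]/(4 * 2)%N exprM z4 sqrrN expr1n.
Qed.

Lemma pchar_sqr_neq0 (K : fieldType) (g : K) (a : int) :
  p \in [pchar K] -> `|a| < p%:Z -> a != 0 -> g ^+ 2 = a%:~R -> g != 0.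
Proof.
move=> pK a_lt a0 g2; rewrite -sqrf_eq0 g2 -(dvdz_pcharf pK).
rewrite dvdzE absz_nat; apply: contraTN a_lt => /dvdn_leq.
by rewrite absz_gt0 a0 -leNgt -abszE lez_nat; apply.
Qed.

(* With [z] a primitive eighth root of unity, [z + z^3] and [z + z^7] are square roots
   of [-2] and [2]; Frobenius permutes the powers of [z]. *)
Lemma legendreN2 :
  legendre (-2 : 'F_p) = if (p %% 8 == 1)%N || (p %% 8 == 3)%N then 1 else -1.
Proof.
have [K [f _]] := countable_algebraic_closure 'F_p.
have pK := pchar_extension f; have [z z4 z8] := eighth_root K.
have p_odd := odd_prime_half.
have g2 : (z + z ^+ 3) ^+ 2 = (-2)%:~R.
  by transitivity (z ^+ 2 + 2 * z ^+ 4 + z ^+ 4 * z ^+ 2); [ring | rewrite z4; ring].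
have g0 : z + z ^+ 3 != 0.
  by apply: (pchar_sqr_neq0 pK) g2 => //; rewrite ltz_nat.
apply: (legendre_sqrt (f := f) g0); first by case: ifP.
  by rewrite g2 !rmorphN /= !rmorph_nat.
rewrite exprDn_pchar ?pnatE // -exprM -(expr_mod (3 * p) z8) -(expr_mod p z8) -modnMmr.
have : (p %% 8 < 8)%N by rewrite ltn_mod.
have : odd (p %% 8) by lia.
have e4 k : z ^+ (4 + k) = - z ^+ k by rewrite exprD z4 mulN1r.
case: (p %% 8)%N => [|[|[|[|[|[|[|[|]]]]]]]] //= _ _.
- by rewrite mul1r.
- by rewrite mul1r addrC.
- by rewrite (e4 1%N) (e4 3%N) mulN1r opprD.
- by rewrite (e4 3%N) (e4 1%N) mulN1r opprD addrC.
Qed.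

Lemma legendre2 :
  legendre (2 : 'F_p) = if (p %% 8 == 1)%N || (p %% 8 == 7)%N then 1 else -1.
Proof.
have [K [f _]] := countable_algebraic_closure 'F_p.
have pK := pchar_extension f; have [z z4 z8] := eighth_root K.
have p_odd := odd_prime_half.
have g2 : (z + z ^+ 7) ^+ 2 = 2%:~R.
  by transitivity (z ^+ 2 + 2 * z ^+ 8 + z ^+ 8 * z ^+ 4 * z ^+ 2); [ring | rewrite z8 z4; ring].
have g0 : z + z ^+ 7 != 0.
  by apply: (pchar_sqr_neq0 pK) g2 => //; rewrite ltz_nat.
apply: (legendre_sqrt (f := f) g0); first by case: ifP.
  by rewrite g2 !rmorph_nat.
rewrite exprDn_pchar ?pnatE // -exprM -(expr_mod (7 * p) z8) -(expr_mod p z8) -modnMmr.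
have : (p %% 8 < 8)%N by rewrite ltn_mod.
have : odd (p %% 8) by lia.
have e4 k : z ^+ (4 + k) = - z ^+ k by rewrite exprD z4 mulN1r.
case: (p %% 8)%N => [|[|[|[|[|[|[|[|]]]]]]]] //= _ _.
- by rewrite mul1r.
- by rewrite (e4 1%N) (e4 3%N) mulN1r opprD opprK addrC.
- by rewrite (e4 1%N) (e4 3%N) mulN1r opprD opprK.
- by rewrite mul1r addrC.
Qed.
End Legendre.

(** * Gauss sums and quadratic reciprocity *)

Section GaussSum.
Variables (q : nat) (K : fieldType) (z : K).
Hypothesis q_pr : prime q.
Hypothesis q_gt2 : (2 < q)%N.
Hypothesis zq : z ^+ q = 1.
Hypothesis z_neq1 : z != 1.

Definition addchar (x : 'F_q) : K := z ^+ x.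

Lemma addchar_nat n : addchar n%:R = z ^+ n.
Proof. by rewrite /addchar val_Fp_nat // expr_mod. Qed.

Lemma addcharD x y : addchar (x + y) = addchar x * addchar y.
Proof. by rewrite -(natr_Zp x) -(natr_Zp y) -natrD !addchar_nat exprD. Qed.

Lemma addchar0 : addchar 0 = 1.
Proof. exact: (addchar_nat 0). Qed.

Lemma sum_addchar u : \sum_x addchar (u * x) = if u == 0 then q%:R else 0.
Proof.
have [->|u0] := eqVneq u 0.
  under eq_bigr do rewrite mul0r addchar0.
  by rewrite sumr_const card_Fp.
rewrite -(reindex_inj (mulfI u0) (F := addchar) (P := xpredT)) /=.
have : \sum_x addchar x = z * \sum_x addchar x.
  rewrite {1}(reindex_inj (addrI 1)) mulr_sumr /=; apply: eq_bigr => x _.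
  by rewrite addcharD (addchar_nat 1) expr1.
move/eqP; rewrite -subr_eq0 -{1}[\sum_x _]mul1r -mulrBl mulf_eq0 subr_eq0 eq_sym.
by rewrite (negbTE z_neq1) => /eqP.
Qed.

Definition gauss_sum : K := \sum_(x : 'F_q) (legendre x)%:~R * addchar x.

(** Replacing the second variable [y] by [x * y] gives a double sum whose inner sum over [x] of
    [addchar (x * (1 + y))] vanishes unless [y = -1]. For [x = 0] the substitution is justified by
    [sum_legendre]. *)
Lemma gauss_sum_sqr : gauss_sum ^+ 2 = (legendre (-1 : 'F_q) * q%:Z)%:~R.
Proof.
have shear (x : 'F_q) :
    (legendre x)%:~R * addchar x * gauss_sum =
    \sum_(y : 'F_q) (legendre y)%:~R * addchar (x + x * y).
  rewrite /gauss_sum; have [->|x0] := eqVneq x 0.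
    rewrite {1}/legendre eqxx !mul0r.
    under eq_bigr do rewrite mul0r addr0 addchar0 mulr1.
    by rewrite -rmorph_sum /= sum_legendre.
  rewrite (reindex_inj (mulfI x0)) mulr_sumr /=; apply: eq_bigr => y _.
  rewrite legendreM // rmorphM /= addcharD.
  have : (legendre x)%:~R ^+ 2 = 1 :> K by rewrite -rmorphXn /= legendre_neq0.
  move: (legendre x)%:~R => l l2.
  transitivity (l ^+ 2 * ((legendre y)%:~R * (addchar x * addchar (x * y)))).
    by ring.
  by rewrite l2 mul1r.
rewrite expr2 {1}/gauss_sum mulr_suml (eq_bigr _ (fun x _ => shear x)) exchange_big /=.
rewrite (bigD1 (-1)) //= [X in _ + X]big1 ?addr0 => [|y y_neq].
  rewrite -mulr_sumr; under eq_bigr do rewrite mulrN1 subrr addchar0.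
  by rewrite sumr_const card_Fp // rmorphM.
rewrite -mulr_sumr; under eq_bigr do rewrite -{1}[X in X + _]mulr1 -mulrDr mulrC.
by rewrite sum_addchar addrC addr_eq0 (negbTE y_neq) mulr0.
Qed.

(** Frobenius sends [addchar x] to [addchar (p * x)] and keeps the odd powers of signs; reindexing
    extracts the symbol of [p]. *)
Lemma gauss_sum_expp p : prime p -> odd p -> p \in [pchar K] -> p != q ->
  gauss_sum ^+ p = (legendre (p%:R : 'F_q))%:~R * gauss_sum.
Proof.
move=> p_pr p_odd pK p_neq_q.
have p0 : (p%:R : 'F_q) != 0 by rewrite -(dvdn_pcharf (pchar_Fp q_pr)) dvdn_prime2 // eq_sym.
rewrite -(pFrobenius_autE pK) rmorph_sum /= /gauss_sum mulr_sumr.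
rewrite [RHS](reindex_inj (mulfI p0)) /=; apply: eq_bigr => x _.
rewrite rmorphM /= !pFrobenius_autE -rmorphXn /= legendre_exp_odd // legendreM // rmorphM /=.
have lp2 : (legendre (p%:R : 'F_q))%:~R * (legendre (p%:R : 'F_q))%:~R = 1 :> K.
  by rewrite -rmorphM /= -expr2 legendre_neq0.
rewrite [RHS]mulrA [X in _ = X * _]mulrA lp2 mul1r; congr (_ * _).
by rewrite -[in RHS](natr_Zp x) -natrM addchar_nat mulnC exprM.
Qed.
End GaussSum.

(** For [q = 1] modulo 4 the Gauss sum is a square root of [q] in characteristic [p], so its [p]-th
    power computes both symbols. *)
Lemma quadratic_reciprocity_1mod4 p q : prime p -> prime q -> (2 < p)%N -> p != q ->
  (q %% 4 = 1)%N -> legendre (p%:R : 'F_q) = legendre (q%:R : 'F_p).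
Proof.
move=> p_pr q_pr p_gt2 p_neq_q q4.
have q_gt2 : (2 < q)%N by have := prime_gt1 q_pr; lia.
have [K [f _]] := countable_algebraic_closure 'F_p.
have pK := pchar_extension p_pr f.
have [z zq z1] : exists2 z : K, z ^+ q = 1 & z != 1.
  pose P : {poly K} := \poly_(i < q) 1.
  have [z rz] : exists z, root P z.
    apply/closed_rootP; rewrite size_poly_eq ?oner_neq0 //; lia.
  have Pz : P.[z] = \sum_(i < q) z ^+ i.
    by rewrite horner_poly; apply: eq_bigr => i _; rewrite mul1r.
  move: rz; rewrite rootE Pz => /eqP sz; exists z.
    by apply/eqP; rewrite -subr_eq0 subrX1 sz mulr0.
  apply/eqP => z1; move: sz; rewrite z1; under eq_bigr do rewrite expr1n.
  rewrite sumr_const card_ord => /eqP; rewrite -(dvdn_pcharf pK) dvdn_prime2 //.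
  exact/negP.
have g2 := gauss_sum_sqr q_pr q_gt2 zq z1.
rewrite legendreN1 // q4 mul1r in g2.
have g0 : gauss_sum q z != 0.
  by rewrite -sqrf_eq0 g2 -(dvdn_pcharf pK) dvdn_prime2.
apply/esym/(legendre_sqrt p_pr p_gt2 (f := f) g0).
- by rewrite legendre_norm.
- by rewrite g2 rmorph_nat.
- by rewrite gauss_sum_expp // (odd_prime_half p_pr) //= odd_double.
Qed.

(** * Legendre's equation and sums of three squares *)

Lemma isqrt_exists n : exists s, (s ^ 2 <= n < s.+1 ^ 2)%N.
Proof.
elim: n => [|n [s /andP[le_s lt_s]]]; first by exists 0%N.
have [lt|ge] := ltnP n.+1 (s.+1 ^ 2); first by exists s; rewrite lt leqW.
exists s.+1; rewrite ge /=; apply: leq_ltn_trans lt_s _.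
by rewrite ltn_exp2r.
Qed.

Lemma sqr_ord_diff_le s n (i j : 'I_s.+1) : (s ^ 2 <= n)%N ->
  ((i : nat)%:Z - (j : nat)%:Z) ^+ 2 <= n%:Z.
Proof.
move=> le_sn; have := ltn_ord i; have := ltn_ord j; move: le_sn.
by move: (i : nat) (j : nat) => a b; rewrite -mulnn; nia.
Qed.

Lemma collision (T U : finType) (f : T -> U) : (#|U| < #|T|)%N ->
  exists x y, x != y /\ f x = f y.
Proof.
move=> lt; have /injectivePn[x [y xy fxy]] : ~~ injectiveb f.
  by apply/negP => /injectiveP/leq_card; rewrite leqNgt lt.
by exists x, y.
Qed.

Lemma eqn_mod_dvdz (a b n : nat) : (a = b %[mod n])%N -> (n %| a%:Z - b%:Z)%Z.
Proof. by move=> ab; rewrite -eqz_mod_dvd !modz_nat ab. Qed.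

Lemma linear_collision2 (q w : nat) : (0 < q)%N ->
  exists x y : int, [/\ (x, y) != 0, (q %| x + w%:Z * y)%Z, x ^+ 2 <= q%:Z & y ^+ 2 <= q%:Z].
Proof.
move=> q_gt0; have [s /andP[le_s lt_s]] := isqrt_exists q.
pose f (u : 'I_s.+1 * 'I_s.+1) : 'I_q := Ordinal (ltn_pmod (u.1 + w * u.2) q_gt0).
have [|[x y] [[x' y'] [neq [/eqn_mod_dvdz dvd]]]] := @collision _ _ f.
  by rewrite card_prod !card_ord mulnn.
exists ((x : nat)%:Z - (x' : nat)%:Z), ((y : nat)%:Z - (y' : nat)%:Z); split.
- apply: contra neq; rewrite -[0]/(0, 0) !xpair_eqE !subr_eq0.
  by rewrite !eqz_nat.
- by move: dvd; rewrite /= !PoszD !PoszM; congr (_ %| _)%Z; ring.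
- exact: sqr_ord_diff_le.
- exact: sqr_ord_diff_le.
Qed.

(** Thue's pigeonhole argument in a box with sides about [sqrt (n * d)], [sqrt n] and [sqrt d],
    which has more than [n * d] points. *)
Lemma linear_collision3 (n d w v : nat) : (0 < n)%N -> (0 < d)%N ->
  exists x y t : int, [/\ (x, y, t) != 0, (n %| x + w%:Z * y)%Z, (d %| x + v%:Z * t)%Z &
    [/\ x ^+ 2 <= (n * d)%N%:Z, y ^+ 2 <= n%:Z & t ^+ 2 <= d%:Z]].
Proof.
move=> n_gt0 d_gt0.
have [a /andP[le_a lt_a]] := isqrt_exists (n * d).
have [b /andP[le_b lt_b]] := isqrt_exists n.
have [c /andP[le_c lt_c]] := isqrt_exists d.
pose f (u : 'I_a.+1 * 'I_b.+1 * 'I_c.+1) : 'I_n * 'I_d :=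
  (Ordinal (ltn_pmod (u.1.1 + w * u.1.2) n_gt0), Ordinal (ltn_pmod (u.1.1 + v * u.2) d_gt0)).
have [|[[x y] t] [[[x' y'] t'] [neq [/eqn_mod_dvdz dvd1 /eqn_mod_dvdz dvd2]]]] := @collision _ _ f.
  rewrite !card_prod !card_ord -(@ltn_exp2r _ _ 2) //.
  have -> : ((n * d) ^ 2 = n * d * (n * d))%N by rewrite mulnn.
  rewrite !(expnMn _ c.+1) expnMn -[ltnRHS]mulnA; apply: ltn_mul => //; exact: ltn_mul.
exists ((x : nat)%:Z - (x' : nat)%:Z), ((y : nat)%:Z - (y' : nat)%:Z), ((t : nat)%:Z - (t' : nat)%:Z).
split.
- apply: contra neq; rewrite -[0]/(0, 0, 0) !xpair_eqE !subr_eq0.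
  by rewrite !eqz_nat.
- by move: dvd1; rewrite /= !PoszD !PoszM; congr (_ %| _)%Z; ring.
- by move: dvd2; rewrite /= !PoszD !PoszM; congr (_ %| _)%Z; ring.
- by split; apply: sqr_ord_diff_le.
Qed.

(** Thue's lemma gives a positive multiple of [q] of the form [a ^ 2 + b ^ 2]; it is below [2 * q]
    because [q] is not a square. *)
Lemma prime_two_squares q : prime q -> (q %% 4 = 1)%N ->
  exists a b : int, q%:Z = a ^+ 2 + b ^+ 2.
Proof.
move=> q_pr q4; have q_gt2 : (2 < q)%N by have := prime_gt1 q_pr; lia.
have [y y2] : exists y : 'F_q, y ^+ 2 = -1.
  by apply: legendre_square => //; rewrite legendreN1 // q4.
have dvd : (q %| y%:Z ^+ 2 + 1)%Z.
  rewrite (dvdz_pcharf (pchar_Fp q_pr)) rmorphD rmorphXn /= -pmulrn.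
  by rewrite natr_Zp y2 addNr.
have [a [b [ab0 lin a2 b2]]] := @linear_collision2 q y (prime_gt0 q_pr).
exists a, b; have : (q %| a ^+ 2 + b ^+ 2)%Z.
  have -> : a ^+ 2 + b ^+ 2 =
    (a + y%:Z * b) * (a - y%:Z * b) + (y%:Z ^+ 2 + 1) * b ^+ 2 by ring.
  by rewrite rpredD // dvdz_mulr.
have neq_q (c : int) : c ^+ 2 != q%:Z.
  apply/eqP => /(congr1 (fun u => logn q (absz u))).
  by rewrite abszX lognX absz_nat (logn_prime _ q_pr) eqxx; lia.
have ab_gt0 : 0 < a ^+ 2 + b ^+ 2.
  rewrite lt_neqAle addr_ge0 ?sqr_ge0 // andbT eq_sym paddr_eq0 ?sqr_ge0 // !sqrf_eq0.
  by move: ab0; rewrite -[0]/(0, 0) xpair_eqE.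
case/dvdzP => c abc; have q0 : 0 < q%:Z by rewrite ltz_nat prime_gt0.
have a_neq := neq_q a; have b_neq := neq_q b.
have c_gt0 : 0 < c by rewrite -(pmulr_lgt0 _ q0) -abc.
have c_lt2 : c < 2 by rewrite -(ltr_pM2r q0) -abc; lia.
have c1 : c = 1 by lia.
by rewrite abc c1 mul1r.
Qed.

(** The collision vector makes [Q] equal to [c * (n * d)], and the size bounds leave [c] among -1,
    0, 1, 2. The value 0 is a solution and 1 is converted into one; 2 and -1 force
    [x ^ 2 = d * y ^ 2] or [t ^ 2 = d], against the hypothesis on [d]. *)
Lemma legendre_equation (n d : nat) (w v : nat) : (0 < n)%N -> (0 < d)%N -> coprime n d ->
  (forall a b : int, a ^+ 2 = d%:Z * b ^+ 2 -> b = 0) ->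
  (n %| w%:Z ^+ 2 + d%:Z)%Z -> (d %| v%:Z ^+ 2 - n%:Z)%Z ->
  exists x y t : int, t != 0 /\ n%:Z * t ^+ 2 = x ^+ 2 + d%:Z * y ^+ 2.
Proof.
move=> n_gt0 d_gt0 co d_nsq wn vd.
have [x [y [t [neq0 lin1 lin2 [x2 y2 t2]]]]] := @linear_collision3 n d w v n_gt0 d_gt0.
pose Q := x ^+ 2 + d%:Z * y ^+ 2 - n%:Z * t ^+ 2.
have : (n%:Z * d%:Z %| Q)%Z.
  rewrite Gauss_dvdz ?coprimezE // /Q; apply/andP; split.
    have -> : x ^+ 2 + d%:Z * y ^+ 2 - n%:Z * t ^+ 2 =
      (x + w%:Z * y) * (x - w%:Z * y) + (w%:Z ^+ 2 + d%:Z) * y ^+ 2 - n%:Z * t ^+ 2 by ring.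
    by rewrite rpredB ?rpredD ?dvdz_mulr.
  have -> : x ^+ 2 + d%:Z * y ^+ 2 - n%:Z * t ^+ 2 =
    (x + v%:Z * t) * (x - v%:Z * t) + (v%:Z ^+ 2 - n%:Z) * t ^+ 2 + d%:Z * y ^+ 2 by ring.
  by rewrite !rpredD ?dvdz_mulr.
case/dvdzP => c; rewrite /Q => Qc.
have n0 : 0 < n%:Z by rewrite ltz_nat.
have d0 : 0 < d%:Z by rewrite ltz_nat.
have x0 := sqr_ge0 x; have y0 := sqr_ge0 y; have t0 := sqr_ge0 t.
rewrite PoszM in x2.
have nd0 : 0 < n%:Z * d%:Z by rewrite mulr_gt0.
have dy2 : d%:Z * y ^+ 2 <= n%:Z * d%:Z by rewrite [leRHS]mulrC ler_pM2l.
have nt2 : n%:Z * t ^+ 2 <= n%:Z * d%:Z by rewrite ler_pM2l.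
have dy0 : 0 <= d%:Z * y ^+ 2 by rewrite mulr_ge0 // ltW.
have nt0 : 0 <= n%:Z * t ^+ 2 by rewrite mulr_ge0 // ltW.
have c_lo : -1 <= c by rewrite -(ler_pM2r nd0) -Qc; clear -x0 dy0 nt2; lia.
have c_hi : c <= 2 by rewrite -(ler_pM2r nd0) -Qc; clear -x2 dy2 nt0; lia.
have nondegenerate : t = 0 -> y = 0 -> x ^+ 2 != 0.
  move=> t_eq0 y_eq0; apply: contra neq0; rewrite sqrf_eq0 => /eqP ->.
  by rewrite t_eq0 y_eq0.
have [c0|c0] := eqVneq c 0.
  exists x, y, t; split; last by move: Qc; rewrite c0 mul0r; clear; lia.
  apply/eqP => t_eq0; move: Qc; rewrite c0 t_eq0 mul0r expr0n mulr0 subr0 => /eqP.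
  rewrite paddr_eq0 // (mulf_eq0 d%:Z) (gt_eqF d0) !sqrf_eq0 /= => /andP[x_eq0 /eqP y_eq0].
  by have := nondegenerate t_eq0 y_eq0; rewrite sqrf_eq0 x_eq0.
have [c1|c1] := eqVneq c 1.
  (* Multiply [x ^ 2 + d * y ^ 2 = n * (t ^ 2 + d)] by [t ^ 2 + d] and compose the two values of the
     form [X ^ 2 + d * Y ^ 2]. *)
  exists (x * t - d%:Z * y), (x + y * t), (t ^+ 2 + d%:Z); split.
    by rewrite gt_eqF // ltr_wpDl.
  have Q1 : x ^+ 2 + d%:Z * y ^+ 2 = n%:Z * (t ^+ 2 + d%:Z).
    by move: Qc; rewrite c1 mul1r mulrDr; clear; lia.
  by rewrite expr2 mulrA -Q1; ring.
have [c2|cN1] : c = 2 \/ c = -1 by clear -c_lo c_hi c0 c1; lia.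
  have xE : x ^+ 2 = n%:Z * d%:Z by move: Qc; rewrite c2; clear -x2 dy2 nt0; lia.
  have dyE : d%:Z * y ^+ 2 = n%:Z * d%:Z by move: Qc; rewrite c2; clear -x2 dy2 nt0; lia.
  have y_eq0 := d_nsq x y (etrans xE (esym dyE)).
  by move: nd0; rewrite -dyE y_eq0 expr0n mulr0.
have nt : n%:Z * t ^+ 2 = n%:Z * d%:Z.
  by move: Qc; rewrite cN1; clear -x0 dy0 nt2; lia.
have t2E : t ^+ 2 = d%:Z * 1 ^+ 2.
  by rewrite expr1n mulr1; apply: (mulfI (lt0r_neq0 n0)).
by have := d_nsq _ _ t2E.
Qed.

Lemma nearest_int (x : int) (t : int) : 0 < t ->
  exists a : int, 4 * (x - a * t) ^+ 2 <= t ^+ 2.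
Proof.
move=> t_gt0; exists ((2 * x + t) %/ (2 * t))%Z.
set a := (_ %/ _)%Z.
have lo : a * (2 * t) <= 2 * x + t by rewrite lez_floor //; lia.
have hi : 2 * x + t < (a + 1) * (2 * t) by rewrite ltz_ceil //; lia.
have -> : 4 * (x - a * t) ^+ 2 = (2 * (x - a * t)) ^+ 2 by ring.
have : -t <= 2 * (x - a * t) <= t by lia.
by move: (2 * _) => r; nia.
Qed.

(* Aubry's descent: the line through the rational point [(x, y, z) / t] and a nearest
   integer point meets the sphere again in a point of smaller denominator. *)
Lemma three_squares_integral (n : int) (x y z t : int) : 0 < t ->
  n * t ^+ 2 = x ^+ 2 + y ^+ 2 + z ^+ 2 ->
  exists a b c : int, n = a ^+ 2 + b ^+ 2 + c ^+ 2.
Proof.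
move def_k: `|t|%N => k; elim/ltn_ind: k x y z t def_k => k IH x y z t def_k t_gt0 E.
have [a ha] := nearest_int x t_gt0; have [b hb] := nearest_int y t_gt0.
have [c hc] := nearest_int z t_gt0.
pose r := (x - a * t) ^+ 2 + (y - b * t) ^+ 2 + (z - c * t) ^+ 2.
pose t' := n * t + (a ^+ 2 + b ^+ 2 + c ^+ 2) * t - 2 * (a * x + b * y + c * z).
have r_t' : r = t * t'.
  have -> : r = (x ^+ 2 + y ^+ 2 + z ^+ 2) - 2 * t * (a * x + b * y + c * z) +
     t ^+ 2 * (a ^+ 2 + b ^+ 2 + c ^+ 2) by rewrite /r; ring.
  by rewrite -E /t'; ring.
have r_ge0 : 0 <= r by rewrite !addr_ge0 ?sqr_ge0.
have t2 : 0 < t ^+ 2 by rewrite exprn_gt0.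
have r_lt : r < t ^+ 2 by rewrite /r; move: ha hb hc t2; clear; lia.
have [r0|r_neq0] := eqVneq r 0.
  exists a, b, c; move: r0 => /eqP; rewrite /r !paddr_eq0 ?addr_ge0 ?sqr_ge0 // !sqrf_eq0 !subr_eq0.
  move=> /andP[/andP[/eqP xE /eqP yE] /eqP zE].
  by apply: (mulIf (lt0r_neq0 t2)); rewrite E xE yE zE; ring.
have t'_gt0 : 0 < t' by rewrite -(pmulr_rgt0 _ t_gt0) -r_t' lt_neqAle eq_sym r_neq0.
have t'_lt : t' < t by rewrite -(ltr_pM2l t_gt0) -r_t' -expr2.
(* Since [m * t + u = t'], the point with coordinates [(m * x + u * a) / t'] and so on lies on the
   line; it is the second intersection. *)
pose m := a ^+ 2 + b ^+ 2 + c ^+ 2 - n.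
pose u := 2 * (n * t - (a * x + b * y + c * z)).
apply: (IH `|t'|%N _ (m * x + u * a) (m * y + u * b) (m * z + u * c) t') => //.
  by rewrite -def_k -ltz_nat !gtz0_abs.
have -> : (m * x + u * a) ^+ 2 + (m * y + u * b) ^+ 2 + (m * z + u * c) ^+ 2 =
  m ^+ 2 * (x ^+ 2 + y ^+ 2 + z ^+ 2) + 2 * m * u * (a * x + b * y + c * z) +
  u ^+ 2 * (a ^+ 2 + b ^+ 2 + c ^+ 2) by ring.
by rewrite -E /t' /u /m; ring.
Qed.

(** * Primes with prescribed residue symbols *)

Definition int_char (M : nat) (c : nat -> int) : Prop :=
  [/\ c 1%N = 1, forall a b, c (a * b)%N = c a * c b, forall a, c (a + M)%N = c a &
      forall a, `|c a| <= 1].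

Lemma int_char_real (R : realType) M c : int_char M c -> real_char M (fun a => (c a)%:~R : R).
Proof.
case=> c1 cM cper cle; split=> [|a b|a|a]; rewrite ?c1 ?cM ?cper ?rmorphM //.
rewrite -rmorphXn /=; congr _%:~R.
have := cle a; rewrite ler_norml => /andP[lo hi].
by have [->|[->|->]] : c a = -1 \/ c a = 0 \/ c a = 1 by clear -lo hi; lia.
Qed.

Lemma prime_prescribed_int_chars (I : finType) (M : nat) (c : I -> nat -> int)
    (eps : I -> int) (B : nat) :
  (0 < M)%N -> (forall i, int_char M (c i)) -> (forall i a, coprime a M -> c i a ^+ 2 = 1) ->
  (forall i, eps i ^+ 2 = 1) ->
  (forall i, exists a, [/\ coprime a M, c i a = -1 & forall j, j != i -> c j a = 1]) ->
  exists p, [/\ prime p, (B < p)%N & forall i, c i p = eps i].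
Proof.
move=> M_gt0 cP c2 eps2 indep.
(* A prime beyond [M] is coprime to [M], so [c i p] is 1 or -1, and [1 + eps i * c i p != 0] then
   means equality with [eps i]. *)
have [||p [p_pr lt_p pP]] := @prime_prescribed_characters Rdefinitions.R I M
  (fun i a => (c i a)%:~R) (fun i => (eps i)%:~R) (maxn B M) M_gt0.
- by move=> i; apply: int_char_real.
- move=> i; have [a [coa ca caj]] := indep i; exists a.
  by split=> [//||j /caj ->//]; rewrite ca.
exists p; rewrite gtn_max in lt_p; case/andP: lt_p => lt_Bp lt_Mp; split=> // i.
have co_pM : coprime p M.
  by rewrite prime_coprime //; apply/negP => /(dvdn_leq M_gt0); rewrite leqNgt lt_Mp.
have := pP i; rewrite -rmorphM -(rmorphD intr 1) /= intr_eq0 => neq0.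
have /eqP := c2 i p co_pM; have /eqP := eps2 i; rewrite !sqrf_eq1.
by case/orP=> /eqP e; case/orP=> /eqP f; move: neq0; rewrite e f.
Qed.

(** For odd primes, [chi4] and [chi8] give the quadratic symbols of -1 and 2. *)
Definition chi4 (a : nat) : int :=
  if (a %% 4 == 1)%N then 1 else if (a %% 4 == 3)%N then -1 else 0.

Definition chi8 (a : nat) : int :=
  if (a %% 8 == 1)%N || (a %% 8 == 7)%N then 1
  else if (a %% 8 == 3)%N || (a %% 8 == 5)%N then -1 else 0.

Lemma chi4M a b : chi4 (a * b) = chi4 a * chi4 b.
Proof.
rewrite /chi4 -modnMm.
have : (a %% 4 < 4)%N by rewrite ltn_mod. have : (b %% 4 < 4)%N by rewrite ltn_mod.
by case: (a %% 4)%N => [|[|[|[|]]]] //; case: (b %% 4)%N => [|[|[|[|]]]].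
Qed.

Lemma chi8M a b : chi8 (a * b) = chi8 a * chi8 b.
Proof.
rewrite /chi8 -modnMm.
have : (a %% 8 < 8)%N by rewrite ltn_mod. have : (b %% 8 < 8)%N by rewrite ltn_mod.
by case: (a %% 8)%N => [|[|[|[|[|[|[|[|]]]]]]]] //; case: (b %% 8)%N => [|[|[|[|[|[|[|[|]]]]]]]].
Qed.

Lemma int_char_chi4 M : (8 %| M)%N -> int_char M chi4.
Proof.
move=> /dvdnP[k ->]; split=> [//|||a]; first exact: chi4M.
  by move=> a; rewrite /chi4 (_ : a + k * 8 = k * 2 * 4 + a)%N ?modnMDl //; clear; lia.
by rewrite /chi4; case: ifP => // _; case: ifP.
Qed.

Lemma int_char_chi8 M : (8 %| M)%N -> int_char M chi8.
Proof.
move=> /dvdnP[k ->]; split=> [//|||a]; first exact: chi8M.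
  by move=> a; rewrite /chi8 addnC modnMDl.
by rewrite /chi8; case: ifP => // _; case: ifP.
Qed.

Lemma int_char_legendre p M : prime p -> (2 < p)%N -> (p %| M)%N ->
  int_char M (fun a => legendre (a%:R : 'F_p)).
Proof.
move=> p_pr p_gt2 pM; split=> [|a b|a|a].
- exact: legendre1.
- by rewrite natrM legendreM.
- by rewrite natrD (eqP (_ : M%:R == 0 :> 'F_p)) ?addr0 // -(dvdn_pcharf (pchar_Fp p_pr)).
- exact: legendre_norm.
Qed.

Lemma chi4_odd_sqr a : odd a -> chi4 a ^+ 2 = 1.
Proof.
move=> a_odd; rewrite /chi4; have : odd (a %% 4) by clear -a_odd; lia.
have : (a %% 4 < 4)%N by rewrite ltn_mod.
by case: (a %% 4)%N => [|[|[|[|]]]].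
Qed.

Lemma chi8_odd_sqr a : odd a -> chi8 a ^+ 2 = 1.
Proof.
move=> a_odd; rewrite /chi8; have : odd (a %% 8) by clear -a_odd; lia.
have : (a %% 8 < 8)%N by rewrite ltn_mod.
by case: (a %% 8)%N => [|[|[|[|[|[|[|[|]]]]]]]].
Qed.

Definition squarefree n := forall p, prime p -> ~~ (p ^ 2 %| n)%N.

Lemma squarefree_dvd m n : (m %| n)%N -> squarefree n -> squarefree m.
Proof. by move=> mn sf p p_pr; apply: contra (sf p p_pr) => /dvdn_trans; apply. Qed.

Lemma squarefree_prod_primes m : (0 < m)%N -> squarefree m -> (\prod_(p <- primes m) p)%N = m.
Proof.
move=> m_gt0 sf; rewrite [RHS](prod_prime_decomp m_gt0) prime_decompE big_map /=.
rewrite big_seq [RHS]big_seq; apply: eq_bigr => p p_m.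
have p_pr : prime p by move: p_m; rewrite mem_primes => /and3P[].
have -> : logn p m = 1%N; last by rewrite expn1.
apply/eqP; rewrite eqn_leq logn_gt0 p_m andbT leqNgt.
by apply: contra (sf p p_pr); rewrite -pfactor_dvdn.
Qed.

Lemma squarefree_coprime_div p m : prime p -> (p %| m)%N -> squarefree m -> coprime p (m %/ p).
Proof.
move=> p_pr pm sf; rewrite prime_coprime //; apply: contra (sf p p_pr).
by move=> dvd; rewrite -(divnK pm) -mulnn dvdn_pmul2r ?prime_gt0.
Qed.

Lemma legendre_mod p a b : prime p -> (a = b %[mod p])%N ->
  legendre (a%:R : 'F_p) = legendre (b%:R : 'F_p).
Proof. by move=> p_pr ab; rewrite -(Fp_nat_mod p_pr a) ab Fp_nat_mod. Qed.

(* Independence of the characters is the Chinese remainder theorem. *)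
Lemma prime_prescribed_residues (m : nat) (e4 e8 : int) (e : nat -> int) (B : nat) :
  odd m -> squarefree m -> e4 ^+ 2 = 1 -> e8 ^+ 2 = 1 ->
  (forall p, prime p -> (p %| m)%N -> e p ^+ 2 = 1) ->
  exists q, [/\ prime q, (B < q)%N, chi4 q = e4, chi8 q = e8 &
    forall p, prime p -> (p %| m)%N -> legendre (q%:R : 'F_p) = e p].
Proof.
move=> m_odd sf e42 e82 e2; have m_gt0 : (0 < m)%N by rewrite odd_gt0.
pose I := (bool + seq_sub (primes m))%type.
pose c (i : I) (a : nat) : int := match i with
  | inl true => chi4 a | inl false => chi8 a
  | inr p => legendre (a%:R : 'F_(ssval p)) end.
pose eps (i : I) : int := match i with inl true => e4 | inl false => e8 | inr p => e (ssval p) end.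
have subP (p : seq_sub (primes m)) : [/\ prime (ssval p), (2 < ssval p)%N & (ssval p %| m)%N].
  case: p => p /=; rewrite mem_primes => /and3P[p_pr _ pm]; split=> //.
  by apply: odd_prime_gt2 => //; apply: dvdn_odd pm m_odd.
have co8m : coprime 8 m by rewrite (@coprime_pexpl 3 2) // coprime2n.
have c_mod1 a (p : seq_sub (primes m)) : (a = 1 %[mod ssval p])%N -> c (inr p) a = 1.
  by have [p_pr p_gt2 _] := subP p => /(legendre_mod p_pr) /= ->; rewrite legendre1.
have [|||||q [q_pr lt_q qP]] := @prime_prescribed_int_chars I (8 * m) c eps B.
- by rewrite muln_gt0.
- case=> [[]|p] /=; [apply: int_char_chi4 | apply: int_char_chi8 |]; rewrite ?dvdn_mulr //.
  by have [p_pr p_gt2 pm] := subP p; apply: int_char_legendre; rewrite ?dvdn_mull.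
- move=> i a; rewrite coprimeMr (@coprime_pexpr 3 a 2) // coprimen2.
  case/andP=> a_odd co_am; case: i => [[]|p] /=; [exact: chi4_odd_sqr|exact: chi8_odd_sqr|].
  have [p_pr p_gt2 pm] := subP p; apply: legendre_neq0.
  by rewrite -(dvdn_pcharf (pchar_Fp p_pr)) -prime_coprime // coprime_sym (coprime_dvdr pm).
- case=> [[]|p] //=; by have [p_pr _ pm] := subP p; apply: e2.
- case=> [b|p].
    (* Modulo 8, the class 7 changes only the sign of [chi4], and 5 only that of [chi8]. *)
    pose r := if b then 7%N else 5%N.
    exists (chinese 8 m r 1).
    have a8 : (chinese 8 m r 1 = r %[mod 8])%N by rewrite chinese_modl.
    have am : (chinese 8 m r 1 = 1 %[mod m])%N by rewrite chinese_modr.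
    split.
    + rewrite coprimeMr -coprime_modl a8 coprime_modl -(coprime_modl _ m) am coprime_modl coprime1n andbT.
      by rewrite /r; case: (b).
    + rewrite /c /chi4 /chi8; have a4 : ((chinese 8 m r 1) %% 4 = (r %% 8) %% 4)%N.
        by rewrite -a8 modn_dvdm.
      by rewrite a4 a8 /r; case: (b).
    + case=> [b' neq|p _].
        rewrite /c /chi4 /chi8; have a4 : ((chinese 8 m r 1) %% 4 = (r %% 8) %% 4)%N.
          by rewrite -a8 modn_dvdm.
        by move: neq; rewrite a4 a8 /r; case: (b); case: (b').
      apply: c_mod1; have [_ _ pm] := subP p.
      by rewrite -(modn_dvdm _ pm) am modn_dvdm.
  have [p_pr p_gt2 pm] := subP p.
  have [x xN1] := legendre_nonresidue p_pr p_gt2.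
  set P := ssval p in p_pr p_gt2 pm x xN1 *.
  have coP : coprime P (8 * (m %/ P)).
    rewrite coprimeMr squarefree_coprime_div // andbT coprime_sym.
    exact: coprime_dvdr pm co8m.
  (* A nonresidue modulo [P] that is 1 modulo 8 and modulo the other primes changes only the symbol
     at [P]. *)
  pose a := chinese P (8 * (m %/ P)) x 1.
  have aP : (a = x %[mod P])%N by rewrite /a chinese_modl.
  have a1 : (a = 1 %[mod 8 * (m %/ P)])%N by rewrite /a chinese_modr.
  have a_dvd d : (d %| 8 * (m %/ P))%N -> (a = 1 %[mod d])%N.
    by move=> dM; rewrite -(modn_dvdm _ dM) a1 modn_dvdm.
  have aN1 : legendre (a%:R : 'F_P) = -1 by rewrite (legendre_mod p_pr aP) natr_Zp.
  exists a; split=> //.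
  + have -> : (8 * m = P * (8 * (m %/ P)))%N by rewrite mulnCA [(P * _)%N]mulnC divnK.
    rewrite coprimeMr -(coprime_modl _ (8 * _)) a1 coprime_modl coprime1n andbT.
    rewrite coprime_sym prime_coprime // (dvdn_pcharf (pchar_Fp p_pr)).
    by rewrite -legendre_eq0 aN1.
  + case=> [b _|p' neq].
      have a8 : (a = 1 %[mod 8])%N by apply: a_dvd; rewrite dvdn_mulr.
      have a4 : (a = 1 %[mod 4])%N by apply: a_dvd; rewrite dvdn_mulr.
      by rewrite /c /chi4 /chi8 a4 a8; case: (b).
    apply: c_mod1; have [p'_pr _ p'm] := subP p'.
    have neqP : ssval p' != P.
      by apply: contra neq => /eqP e'; apply/eqP; congr inr; apply: val_inj.
    apply: a_dvd; apply: dvdn_mull; move: (ssval p') p'_pr p'm neqP => p1 p1_pr.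
    rewrite -{1}(divnK pm) Euclid_dvdM // => + neqP.
    by case/orP=> //; rewrite dvdn_prime2 // => /eqP p1P; move: neqP; rewrite p1P => /eqP.
exists q; split=> //; [exact: (qP (inl true))|exact: (qP (inl false))|].
move=> p p_pr pm; have p_m : p \in primes m by rewrite mem_primes p_pr m_gt0.
exact: (qP (inr (SeqSub p_m))).
Qed.

Lemma neg_square_mod_squarefree n d : (0 < n)%N -> squarefree n ->
  (forall p, prime p -> (p %| n)%N -> exists y, (p %| y ^ 2 + d)%N) ->
  exists w, (n %| w ^ 2 + d)%N.
Proof.
elim/ltn_ind: n => n IH n_gt0 sf loc; have [n_gt1|] := ltnP 1 n; last first.
  by rewrite leq_eqVlt ltnNge n_gt0 orbF => /eqP ->; exists 0%N; apply: dvd1n.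
have p_pr := pdiv_prime n_gt1; have pn := pdiv_dvd n; set p := pdiv n in p_pr pn.
have co := squarefree_coprime_div p_pr pn sf.
have [y yp] := loc p p_pr pn.
have [||||w wn] := IH (n %/ p)%N.
- by rewrite ltn_Pdiv // prime_gt1.
- by rewrite divn_gt0 ?prime_gt0 // dvdn_leq.
- exact: squarefree_dvd (dvdn_div pn) sf.
- by move=> r r_pr rn; apply: loc => //; apply: dvdn_trans rn (dvdn_div pn).
exists (chinese p (n %/ p) y w); rewrite -[X in (X %| _)%N](divnK pn) mulnC Gauss_dvd //.
have lift r z : (chinese p (n %/ p) y w = z %[mod r])%N -> (r %| z ^ 2 + d)%N ->
    (r %| chinese p (n %/ p) y w ^ 2 + d)%N.
  move: (chinese _ _ _ _) => x xz.
  by rewrite /dvdn -[in X in _ -> X]modnDml -[in X in _ -> X]modnXm xz modnXm modnDml.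
by rewrite (lift p y) ?(lift _ w) ?chinese_modl ?chinese_modr.
Qed.

Lemma legendre_neg_square p d : prime p -> (2 < p)%N ->
  legendre (- d%:R : 'F_p) = 1 -> exists y, (p %| y ^ 2 + d)%N.
Proof.
move=> p_pr p_gt2 /(legendre_square p_pr p_gt2)[y y2]; exists y.
by rewrite (dvdn_pcharf (pchar_Fp p_pr)) natrD natrX natr_Zp y2 addNr.
Qed.

(** With [e * q = a ^ 2 + b ^ 2], a solution of [n t ^ 2 = x ^ 2 + e q y ^ 2] makes [n t ^ 2] the
    sum of the squares of [x], [a y] and [b y]. *)
Lemma three_squares_from_prime n e q :
  (0 < n)%N -> squarefree n -> (e = 1%N \/ e = 2%N /\ odd n) ->
  prime q -> (q %% 4 = 1)%N -> (n < q)%N ->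
  (forall p, prime p -> (2 < p)%N -> (p %| n)%N -> legendre (- (e * q)%:R : 'F_p) = 1) ->
  legendre (n%:R : 'F_q) = 1 ->
  exists x y z : int, n%:Z = x ^+ 2 + y ^+ 2 + z ^+ 2.
Proof.
move=> n_gt0 sf e12 q_pr q4 lt_nq legp legq.
have q_gt2 : (2 < q)%N by have := prime_gt1 q_pr; clear -q4; lia.
have q_odd : odd q by clear -q4; lia.
have e_gt0 : (0 < e)%N by case: e12 => [->|[-> _]].
have d_gt0 : (0 < e * q)%N by rewrite muln_gt0 e_gt0 prime_gt0.
have [a [b dE]] : exists a b : int, (e * q)%N%:Z = a ^+ 2 + b ^+ 2.
  have [a [b qE]] := prime_two_squares q_pr q4.
  case: e12 => [->|[-> _]]; first by exists a, b; rewrite mul1n.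
  by exists (a + b), (a - b); rewrite PoszM qE; ring.
have co_nd : coprime n (e * q).
  rewrite coprimeMr; apply/andP; split; first by case: e12 => [->|[-> ?]]; rewrite ?coprimen1 ?coprimen2.
  by rewrite coprime_sym prime_coprime //; apply/negP => /(dvdn_leq n_gt0); rewrite leqNgt lt_nq.
have nsq (x y : int) : x ^+ 2 = (e * q)%N%:Z * y ^+ 2 -> y = 0.
  move=> E; apply/eqP; apply: contraTT isT => y0.
  have yN : (0 < `|y|)%N by rewrite absz_gt0.
  have := congr1 (fun u => logn q (absz u)) E.
  rewrite abszM !abszX absz_nat lognX lognM ?expn_gt0 ?yN // lognX lognM ?(prime_gt0 q_pr) //.
  rewrite (logn_prime _ q_pr) eqxx.
  have -> : logn q e = 0%N by case: e12 => [->|[-> _]]; rewrite ?logn1 // logn_prime // gtn_eqF.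
  by clear; lia.
have [w wn] : exists w, (n %| w ^ 2 + e * q)%N.
  apply: neg_square_mod_squarefree => // p p_pr pn.
  have [p2|p_odd] := even_prime p_pr; last first.
    by have p_gt2 := odd_prime_gt2 p_odd p_pr; apply: legendre_neg_square => //; apply: legp.
  (* For [p = 2], the choice [y = d] works because [d ^ 2 + d] is even. *)
  by exists (e * q)%N; rewrite p2 dvdn2 oddD oddX addbb.
have [v vd] : exists v : nat, ((e * q)%N %| v%:Z ^+ 2 - n%:Z)%Z.
  have [y y2] := legendre_square q_pr q_gt2 legq.
  have yq (k : nat) : (q %| (y + k * q)%N%:Z ^+ 2 - n%:Z)%Z.
    rewrite (dvdz_pcharf (pchar_Fp q_pr)) rmorphB rmorphXn /= -!pmulrn natrD natrM.
    by rewrite (pchar_Fp_0 q_pr) mulr0 addr0 natr_Zp y2 subrr.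
  case: e12 => [->|[-> n_odd]]; first by exists (y + 0 * q)%N; rewrite mul1n.
  (* Adding the odd [q] changes the parity of the root, so it can be taken odd like [n], which
     settles the factor 2. *)
  have [k yk] : exists k, odd (y + k * q).
    by exists (~~ odd y); rewrite oddD oddM q_odd andbT; case: (odd y).
  exists (y + k * q)%N; rewrite PoszM Gauss_dvdz ?yq ?andbT; last first.
    by rewrite coprimezE coprime2n.
  by move: yk n_odd; move: (y + k * q)%N => u; clear; lia.
have wn' : (n %| w%:Z ^+ 2 + (e * q)%N%:Z)%Z by rewrite expr2 -PoszM mulnn -PoszD.
have [x [y [t [t0 E]]]] := legendre_equation n_gt0 d_gt0 co_nd nsq wn' vd.
apply: (@three_squares_integral n%:Z x (a * y) (b * y) `|t|); first by rewrite normr_gt0.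
by rewrite real_normK ?num_real // E dE; ring.
Qed.

Lemma prod_primes_morph (f : nat -> int) m : (0 < m)%N -> squarefree m ->
  f 1%N = 1 -> (forall a b, f (a * b)%N = f a * f b) ->
  \prod_(p <- primes m) f p = f m.
Proof.
by move=> m_gt0 sf f1 fM; rewrite -{2}(squarefree_prod_primes m_gt0 sf) (big_morph f fM f1).
Qed.

(** By reciprocity the symbol of [m] modulo [q] is the product over [p] dividing [m] of the symbols
    of [q], prescribed as those of [- e] so that [- e * q] is a square modulo [p]. For [e = 1] the
    product is [chi4 m], right if [n = 1] modulo 4; for [e = 2] it is [chi4 m * chi8 m], right if
    [n = 3] modulo 8; for even [n], the class of [q] modulo 8 corrects the sign. *)
Lemma three_squares_squarefree n : (0 < n)%N -> squarefree n -> (n %% 8 != 7)%N ->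
  exists x y z : int, n%:Z = x ^+ 2 + y ^+ 2 + z ^+ 2.
Proof.
move=> n_gt0 sf n8.
(* [n] is [m] or [2 * m]; the signs are chosen so that [n] is a square modulo [q]. *)
have [e [m [e8 [e12 m_odd mn sgn legn]]]] : exists e m : nat, exists e8 : int,
  [/\ e = 1%N \/ e = 2%N /\ odd n, odd m, (m %| n)%N /\ (n %| 2 * m)%N, e8 ^+ 2 = 1 &
  forall q, prime q -> (q %% 4 = 1)%N -> chi8 q = e8 ->
    legendre (m%:R : 'F_q) = \prod_(p <- primes m) legendre (- e%:R : 'F_p) ->
    legendre (n%:R : 'F_q) = 1].
  have primes_odd m p : odd m -> p \in primes m -> prime p /\ (2 < p)%N.
    move=> m_odd; rewrite mem_primes => /and3P[p_pr _ pm]; split=> //.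
    by apply: odd_prime_gt2 => //; apply: dvdn_odd pm m_odd.
  have prodN1 m : odd m -> squarefree m ->
      \prod_(p <- primes m) legendre (- 1%:R : 'F_p) = chi4 m.
    move=> m_odd sfm; rewrite -(prod_primes_morph (odd_gt0 m_odd) sfm _ chi4M) //.
    rewrite big_seq [RHS]big_seq; apply: eq_bigr => p /(primes_odd _ _ m_odd)[p_pr p_gt2].
    rewrite legendreN1 // /chi4; case: ifP => // p1; rewrite ifT //.
    by have := odd_prime_half p_pr p_gt2; move: p1; clear; lia.
  have prodN2 m : odd m -> squarefree m ->
      \prod_(p <- primes m) legendre (- 2%:R : 'F_p) = chi4 m * chi8 m.
    move=> m_odd sfm; rewrite -(prod_primes_morph (odd_gt0 m_odd) sfm _ chi4M) //.
    rewrite -(prod_primes_morph (odd_gt0 m_odd) sfm _ chi8M) // -big_split.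
    rewrite big_seq [RHS]big_seq; apply: eq_bigr => p /(primes_odd _ _ m_odd)[p_pr p_gt2].
    rewrite legendreN2 // /chi4 /chi8 /= -(@modn_dvdm 8 p 4) //.
    have : odd (p %% 8) by have := odd_prime_half p_pr p_gt2; clear; lia.
    have : (p %% 8 < 8)%N by rewrite ltn_mod.
    by case: (p %% 8)%N => [|[|[|[|[|[|[|[|]]]]]]]].
  have [n_odd|n_even] := boolP (odd n).
    have [n4|n4] := eqVneq (n %% 4)%N 1%N.
      exists 1%N, n, 1; split=> //; [by left|by rewrite dvdn_mull|].
      by move=> q q_pr q4 _ ->; rewrite prodN1 // /chi4 n4.
    exists 2%N, n, 1; split=> //; [by right|by rewrite dvdn_mull|].
    move=> q q_pr q4 _ ->; rewrite prodN2 // /chi4 /chi8.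
    have -> : (n %% 8 = 3)%N by move: n_odd n8 n4; clear; lia.
    by have -> : (n %% 4 = 3)%N by move: n_odd n4; clear; lia.
  pose m := n./2.
  have nE : n = (2 * m)%N by rewrite mul2n -[LHS]odd_double_half (negbTE n_even).
  have m_odd : odd m.
    by have := sf 2 isT; rewrite {1}nE -mulnn dvdn_pmul2l // dvdn2 negbK.
  have sfm : squarefree m by apply: squarefree_dvd sf; rewrite nE dvdn_mull.
  exists 1%N, m, (chi4 m); split=> //; [by left|by rewrite nE dvdn_mull|exact: chi4_odd_sqr|].
  move=> q q_pr q4 q8 legm; have q_gt2 : (2 < q)%N by have := prime_gt1 q_pr; clear -q4; lia.
  rewrite nE natrM legendreM // legm prodN1 // legendre2 //.
  have -> : (if (q %% 8 == 1)%N || (q %% 8 == 7)%N then 1 else -1) = chi8 q.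
    rewrite /chi8; case: ifP => // q1; rewrite ifT //.
    by have := odd_prime_half q_pr q_gt2; move: q1; clear; lia.
  by rewrite q8 -expr2 chi4_odd_sqr.
have [mn1 mn2] := mn; have m_gt0 := odd_gt0 m_odd.
have sfm := squarefree_dvd mn1 sf.
have e_gt0 : (0 < e)%N by case: e12 => [->|[-> _]].
have primes_p p : prime p -> (p %| m)%N -> (2 < p)%N.
  by move=> p_pr pm; apply: odd_prime_gt2 => //; apply: dvdn_odd pm m_odd.
have leg_e2 p : prime p -> (p %| m)%N -> legendre (- e%:R : 'F_p) ^+ 2 = 1.
  move=> p_pr pm; apply: legendre_neq0; rewrite oppr_eq0 -(dvdn_pcharf (pchar_Fp p_pr)).
  have := primes_p p p_pr pm; apply: contraL => /(dvdn_leq e_gt0) le_pe; rewrite -leqNgt.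
  by apply: leq_trans le_pe _; case: e12 => [->|[-> _]].
have [q [q_pr lt_q q4 q8 qp]] := @prime_prescribed_residues m 1 e8
   (fun p => legendre (- e%:R : 'F_p)) n m_odd sfm (expr1n _ _) sgn leg_e2.
have {}q4 : (q %% 4 = 1)%N.
  by move: q4; rewrite /chi4; case: ifP => [/eqP//|_]; case: ifP.
have q_gt2 : (2 < q)%N by have := prime_gt1 q_pr; clear -q4; lia.
apply: (three_squares_from_prime (e := e) (q := q)) => //.
  move=> p p_pr p_gt2 pn; have pm : (p %| m)%N.
    move: (dvdn_trans pn mn2); rewrite Euclid_dvdM // => /orP[p2|//].
    by have := @dvdn_leq p 2 isT p2; rewrite leqNgt p_gt2.
  by rewrite natrM -mulNr legendreM // qp // -expr2 leg_e2.
apply: (legn q) => //.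
transitivity (\prod_(p <- primes m) legendre (p%:R : 'F_q)).
  rewrite (prod_primes_morph (f := fun a => legendre (a%:R : 'F_q))) ?legendre1 //.
  by move=> a b; rewrite natrM legendreM.
rewrite big_seq [RHS]big_seq; apply: eq_bigr => p; rewrite mem_primes => /and3P[p_pr _ pm].
rewrite (quadratic_reciprocity_1mod4 p_pr q_pr) ?qp ?primes_p //.
apply/eqP => pq; move: (dvdn_leq m_gt0 pm); rewrite pq leqNgt.
by rewrite (leq_ltn_trans (dvdn_leq n_gt0 mn1)).
Qed.

Lemma squarefree_decomposition n : (0 < n)%N ->
  exists k m, [/\ (0 < m)%N, squarefree m & n = (k ^ 2 * m)%N].
Proof.
elim/ltn_ind: n => n IH n_gt0.
have [/existsP[p /andP[p_pr pn]]|] :=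
    boolP [exists p : 'I_n.+1, prime p && ((p : nat) ^ 2 %| n)%N]; last first.
  rewrite negb_exists => /forallP none; exists 1%N, n; split; rewrite ?mul1n // => p p_pr.
  apply/negP => pn; have lt_pn : (p < n.+1)%N.
    by rewrite ltnS (leq_trans _ (dvdn_leq n_gt0 pn)) // -mulnn leq_pmull ?prime_gt0.
  by have := none (Ordinal lt_pn); rewrite /= p_pr pn.
have p2 : (1 < (p : nat) ^ 2)%N by rewrite -(exp1n 2) ltn_exp2r ?prime_gt1.
have [||k [m [m_gt0 sf nE]]] := IH (n %/ (p : nat) ^ 2)%N.
- exact: ltn_Pdiv.
- by rewrite divn_gt0 ?(ltnW p2) //; apply: dvdn_leq.
by exists (k * p)%N, m; split=> //; rewrite -{1}(divnK pn) nE expnMn; ring.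
Qed.

Lemma three_squares n : (forall k l, n <> 4 ^ k * (8 * l + 7))%N ->
  exists x y z : int, n%:Z = x ^+ 2 + y ^+ 2 + z ^+ 2.
Proof.
move=> nonexc; have [->|n_gt0] := posnP n; first by exists 0, 0, 0.
have [k [m [m_gt0 sf nE]]] := squarefree_decomposition n_gt0.
have k_gt0 : (0 < k)%N by move: n_gt0; rewrite nE muln_gt0 expn_gt0 orbF => /andP[].
have m8 : (m %% 8 != 7)%N.
  (* Write [k] as a power of 2 times an odd [r]; then [r ^ 2 * m] is still 7 modulo 8, and [n] would
     be excluded. *)
  apply/eqP => m8; have [r cor kE] := pfactor_coprime (isT : prime 2) k_gt0.
  have r_odd : odd r by rewrite -coprime2n.
  apply: (nonexc (logn 2 k) ((r ^ 2 * m) %/ 8)%N).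
  have r8 : (r ^ 2 * m %% 8 = 7)%N.
    rewrite -modnMm m8 -modnXm; have : odd (r %% 8) by clear -r_odd; lia.
    have : (r %% 8 < 8)%N by rewrite ltn_mod.
    by case: (r %% 8)%N => [|[|[|[|[|[|[|[|]]]]]]]].
  have -> : (8 * (r ^ 2 * m %/ 8) + 7 = r ^ 2 * m)%N by rewrite [RHS](divn_eq _ 8) r8 mulnC.
  by rewrite nE {1}kE expnMn -expnM mulnC (mulnC (logn 2 k)) expnM [RHS]mulnC; ring.
have [x [y [z mE]]] := three_squares_squarefree m_gt0 sf m8.
exists (k%:Z * x), (k%:Z * y), (k%:Z * z).
by rewrite nE PoszM mE -mulnn PoszM; ring.
Qed.

(** * The quaternary form *)

Lemma three_squares_nat n : (forall k l, n <> 4 ^ k * (8 * l + 7))%N ->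
  exists x y z, n = (x ^ 2 + y ^ 2 + z ^ 2)%N.
Proof.
case/three_squares => x [y [z E]]; exists `|x|%N, `|y|%N, `|z|%N.
apply/eqP; rewrite -eqz_nat E !PoszD -!mulnn !PoszM !abszE -!normrM.
by rewrite -!expr2 !ger0_norm ?sqr_ge0.
Qed.

Unset Implicit Arguments.
(* MathComp shadows both [form] and the [ring] tactic on [Z]. *)
From Stdlib Require Import ZArithRing.
Import Defs.
Local Open Scope Z_scope.

Ltac mod_lia := Z.to_euclidean_division_equations; lia.

Lemma sum_three_squares_Z (n : Z) : 0 <= n -> n mod 2 = 0 -> n mod 16 <> 0 -> n mod 32 <> 28 ->
  exists a b c : Z, n = a * a + b * b + c * c.
Proof.
intros n_ge0 n2 n16 n32.
destruct (@three_squares_nat (Z.to_nat n)) as [x [y [z E]]].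
- intros k l E.
  (* For [k = 0] the excluded number is odd, for [k = 1] it is 28 modulo 32, and beyond that a
     multiple of 16. *)
  destruct k as [|[|k]].
  + rewrite expn0 in E; mod_lia.
  + rewrite expn1 in E; mod_lia.
  + rewrite !expnS mulnA -mulnA in E.
    revert E; generalize (4 ^ k * (8 * l + 7))%N; intros t E; mod_lia.
- exists (Z.of_nat x), (Z.of_nat y), (Z.of_nat z).
  rewrite -!mulnn in E; nia.
Qed.

Lemma square_sign_mod3 (a : Z) : exists a', a' * a' = a * a /\ (a' mod 3 = 0 \/ a' mod 3 = 1).
Proof.
destruct (Z.eq_dec (a mod 3) 2) as [a2|a2].
- exists (- a); split; [ring|right; mod_lia].
- exists a; split; [ring|mod_lia].
Qed.

Lemma square_mod3 (a : Z) : (a mod 3 = 0 \/ a mod 3 = 1) ->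
  exists k, a * a = 3 * k + a mod 3.
Proof.
intros [a3|a3]; rewrite a3.
- exists (3 * (a / 3) * (a / 3)); rewrite (Z.div_mod a 3) ?a3; mod_lia.
- exists (3 * (a / 3) * (a / 3) + 2 * (a / 3)).
  pose proof (Z.div_mod a 3 ltac:(lia)) as E; rewrite a3 in E.
  set (t := a / 3) in *; rewrite E; ring.
Qed.

(* [6 (2 k^2 + d^2 + d f + f^2)] is the sum of the squares of [2 k + 2 d + f],
   [2 k - d + f] and [2 k - d - 2 f]. *)
Lemma ternary_represents (m : Z) : 0 <= m ->
  m mod 16 <> 0 -> m mod 16 <> 8 -> m mod 16 <> 10 ->
  exists x z w : Z, m = 2 * x ^ 2 + (z ^ 2 + z * w + w ^ 2).
Proof.
intros m_ge0 m0 m8 m10.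
(* [6 * m] is 0 modulo 16 when [m] is 0 or 8 modulo 16, and 28 modulo 32 when [m] is 10 modulo
   16. *)
destruct (sum_three_squares_Z (6 * m)) as [a0 [b0 [c0 E]]]; try mod_lia.
destruct (square_sign_mod3 a0) as [a [aE a3]].
destruct (square_sign_mod3 b0) as [b [bE b3]].
destruct (square_sign_mod3 c0) as [c [cE c3]].
rewrite <- aE, <- bE, <- cE in E; clear a0 b0 c0 aE bE cE.
destruct (square_mod3 a a3) as [ka ka2], (square_mod3 b b3) as [kb kb2], (square_mod3 c c3) as [kc kc2].
(* The squares sum to 0 modulo 3, so all or none of [a], [b], [c] are divisible by 3. With the
   parity below, [a + b + c] is then a multiple of 6. *)
assert (ab : a mod 3 = b mod 3) by mod_lia.
assert (ac : a mod 3 = c mod 3) by mod_lia.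
assert (even : (a + b + c) mod 2 = 0).
{ assert (exists s, a * a + b * b + c * c = (a + b + c) + 2 * s) as [s hs]; [|mod_lia].
  assert (par : forall u, exists t, u * u = u + 2 * t).
  { intro u; destruct (Zeven_odd_dec u) as [h|h].
    - apply Zeven_ex in h; destruct h as [v ->]; exists (2 * v * v - v); ring.
    - apply Zodd_ex in h; destruct h as [v ->]; exists (2 * v * v + v); ring. }
  destruct (par a) as [ta ha], (par b) as [tb hb], (par c) as [tc hc].
  exists (ta + tb + tc); mod_lia. }
pose (k := (a + b + c) / 6); pose (d := (a - b) / 3); pose (f := a - 2 * k - 2 * d).
assert (sk : a + b + c = 6 * k) by (unfold k; mod_lia).
assert (sd : a - b = 3 * d) by (unfold d; mod_lia).
exists k, d, f.
assert (aE : a = 2 * k + 2 * d + f) by (unfold f; ring).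
assert (bE : b = 2 * k - d + f) by mod_lia.
assert (cE : c = 2 * k - d - 2 * f) by mod_lia.
clearbody k d f; subst a b c.
assert (6 * m = 6 * (2 * k ^ 2 + (d ^ 2 + d * f + f ^ 2))); [rewrite E; ring | mod_lia].
Qed.

(** 2 is inert in the Eisenstein integers: the norm is odd unless [z] and [w] are both even, and
    then 4 divides it. *)
Lemma hexagonal_not_2mod4 (z w : Z) : (z ^ 2 + z * w + w ^ 2) mod 4 <> 2.
Proof.
destruct (Zeven_odd_dec z) as [hz|hz]; [apply Zeven_ex in hz | apply Zodd_ex in hz];
destruct (Zeven_odd_dec w) as [hw|hw]; [apply Zeven_ex in hw | apply Zodd_ex in hw | apply Zeven_ex in hw | apply Zodd_ex in hw];
destruct hz as [u ->], hw as [v ->].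
- replace (_ + _) with (4 * (u * u + u * v + v * v)) by ring; mod_lia.
- replace (_ + _) with (2 * (2 * (u * u) + 2 * (u * v) + u + 2 * (v * v) + 2 * v) + 1) by ring; mod_lia.
- replace (_ + _) with (2 * (2 * (u * u) + 2 * u + 2 * (u * v) + v + 2 * (v * v)) + 1) by ring; mod_lia.
- replace (_ + _) with (2 * (2 * (u * u) + 3 * u + 2 * (u * v) + 3 * v + 2 * (v * v) + 1) + 1) by ring; mod_lia.
Qed.

Lemma hexagonal_mod4_0 (z w : Z) : (z ^ 2 + z * w + w ^ 2) mod 4 = 0 ->
  exists u v, z ^ 2 + z * w + w ^ 2 = 4 * (u ^ 2 + u * v + v ^ 2).
Proof.
destruct (Zeven_odd_dec z) as [hz|hz]; [apply Zeven_ex in hz | apply Zodd_ex in hz];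
destruct (Zeven_odd_dec w) as [hw|hw]; [apply Zeven_ex in hw | apply Zodd_ex in hw | apply Zeven_ex in hw | apply Zodd_ex in hw];
destruct hz as [u ->], hw as [v ->].
- intros _; exists u, v; ring.
- replace (_ + _) with (2 * (2 * (u * u) + 2 * (u * v) + u + 2 * (v * v) + 2 * v) + 1) by ring; mod_lia.
- replace (_ + _) with (2 * (2 * (u * u) + 2 * u + 2 * (u * v) + v + 2 * (v * v)) + 1) by ring; mod_lia.
- replace (_ + _) with (2 * (2 * (u * u) + 3 * u + 2 * (u * v) + 3 * v + 2 * (v * v) + 1) + 1) by ring; mod_lia.
Qed.

(** If [b > 10], then [y = 0] and the hexagonal part is 10, 8 or 2. The values 10 and 2 are 2 modulo
    4, and 8 would descend to 2. *)
Lemma form_ten_bound (b : Z) : universal b -> b <= 10.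
Proof.
intros U; destruct (U 10 ltac:(lia)) as [x [y [z [w E]]]]; unfold form in E.
destruct (Z_le_gt_dec b 10) as [|b_gt]; [assumption|exfalso].
assert (N0 : 0 <= z ^ 2 + z * w + w ^ 2).
{ assert (4 * (z ^ 2 + z * w + w ^ 2) = (2 * z + w) * (2 * z + w) + 3 * (w * w)) by ring.
  pose proof (Z.square_nonneg (2 * z + w)); pose proof (Z.square_nonneg w); lia. }
assert (n2 := hexagonal_not_2mod4 z w); assert (n4 := hexagonal_mod4_0 z w).
set (N := z ^ 2 + z * w + w ^ 2) in *.
replace (x ^ 2) with (x * x) in E by ring.
replace (y ^ 2) with (y * y) in E by ring.
clearbody N.
assert (x2 := Z.square_nonneg x).
assert (y0 : y = 0); [|subst y].
{ destruct (Z.eq_dec y 0) as [|y_neq]; [assumption|exfalso].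
  assert (y2 : 1 <= y * y) by (clear - y_neq; nia).
  assert (by2 : 11 * 1 <= b * (y * y)) by (apply Z.mul_le_mono_nonneg; lia).
  clear n2 n4; lia. }
assert (h : N = 10 - 2 * (x * x)) by (clear n2 n4; lia).
assert (x5 : x * x <= 5) by (clear n2 n4; lia).
assert (-2 <= x <= 2) by (clear - x5; nia).
assert (x = -2 \/ x = -1 \/ x = 0 \/ x = 1 \/ x = 2) as C by mod_lia.
assert (N8 : N = 8).
{ destruct C as [-> | [-> | [-> | [-> | ->]]]]; rewrite h in n2; try (rewrite h; reflexivity);
  exfalso; apply n2; reflexivity. }
destruct n4 as [u [v E4]]; [rewrite N8; reflexivity|].
apply (hexagonal_not_2mod4 u v).
assert (u ^ 2 + u * v + v ^ 2 = 2) as -> by lia; reflexivity.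
Qed.

Lemma form_of_ternary (b m y : Z) : 0 <= m ->
  m mod 16 <> 0 -> m mod 16 <> 8 -> m mod 16 <> 10 ->
  exists x y' z w, form b x y' z w = m + b * y ^ 2.
Proof.
intros h0 h1 h2 h3; destruct (ternary_represents m h0 h1 h2 h3) as [x [z [w E]]].
exists x, y, z, w; unfold form; rewrite E; ring.
Qed.

Lemma form_represents (b n : Z) : 2 <= b <= 10 -> 0 <= n ->
  exists x y z w, form b x y z w = n.
Proof.
intros hb; revert n; apply (Zlt_0_ind (fun n => exists x y z w, form b x y z w = n)); intros n IH n_ge0.
destruct (Z.eq_dec n 0) as [->|n0]; [exists 0, 0, 0, 0; unfold form; ring|].
destruct (Z.eq_dec (n mod 4) 0) as [n4|n4].
{ destruct (IH (n / 4)) as [x [y [z [w E]]]]; try mod_lia.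
  exists (2 * x), (2 * y), (2 * z), (2 * w).
  transitivity (4 * form b x y z w); [unfold form; ring | rewrite E; mod_lia]. }
destruct (Z.eq_dec (n mod 16) 10) as [n10|n10].
2: { destruct (form_of_ternary b n 0) as [x [y [z [w E]]]]; try mod_lia.
  exists x, y, z, w; rewrite E; ring. }
pose (l := n / 16); assert (nE : n = 16 * l + 10) by (unfold l; mod_lia).
assert (l_ge0 : 0 <= l) by (unfold l; mod_lia); clearbody l.
assert (rep : forall m y, 0 <= m -> m mod 16 <> 0 -> m mod 16 <> 8 -> m mod 16 <> 10 ->
  n = m + b * y ^ 2 -> exists x y z w, form b x y z w = n).
{ intros m y h0 h1 h2 h3 ->; apply form_of_ternary; assumption. }
assert (b = 2 \/ b = 10 \/ (b <> 2 /\ b <> 10)) as [b2|[b10|[b2 b10]]] by lia.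
(* Modulo 16, [n - 8] is 2 while [n - 2] would be 8. For [b = 10], [n - 10] would be 0 and [n - 40]
   is 2, but negative for 10 and 26, which are given directly. Otherwise [n - b] is between 1 and 7
   modulo 16. *)
- apply (rep (n - 8) 2); rewrite ?b2; mod_lia.
- destruct (Z.eq_dec l 0) as [l0|l0]; [exists 0, 1, 0, 0; unfold form; lia|].
  destruct (Z.eq_dec l 1) as [l1|l1]; [exists 0, 1, 4, 0; unfold form; lia|].
  apply (rep (n - 40) 2); rewrite ?b10; mod_lia.
- apply (rep (n - b) 1); mod_lia.
Qed.

Theorem theorem3p7 (b : Z) (hb : 2 <= b) :
  universal b <-> 2 <= b <= 10.
Proof.
split.
- intros U; split; [exact hb | exact (form_ten_bound b U)].
- intros hb' n n_ge0; exact (form_represents b n hb' n_ge0).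
Qed.
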